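(* Bounded and unbounded C2E \textsc{Nondeterministic Constraint Logic} and bounded and unbounded C2C \textsc{Nondeterministic Constraint Logic} are all fixed-parameter tractable with respect to the parameter $l+\Delta$, where $l$ is the solution length and $\Delta$ is the maximum degree of the input constraint graph.
   Context: A constraint graph is an undirected graph with a positive integer weight on every edge and a nonnegative integer weight (its minimum inflow) on every vertex. A legal configuration is an assignment of an orientation to every edge such that for every vertex, the total weight of the edges oriented into that vertex is at least that vertex's minimum inflow. A reconfiguration sequence is a sequence of legal configurations in which each configuration is obtained from the previous one by reversing exactly one edge; its length is the number of edge reversals; it is bounded if every edge is reversed at most once. C2C NCL: given a constraint graph $G$, legal configurations $C_1,C_2$ and an integer $l$, is there a reconfiguration sequence from $C_1$ to $C_2$ of length at most $l$? C2E NCL: given $G$, a target edge $e$, a legal configuration $C_1$ and an integer $l$, is there a reconfiguration sequence of length at most $l$ starting at $C_1$ that reverses $e$? The bounded variants additionally require the sequence to be bounded. *)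

(* Defs.v *)
From mathcomp Require Import all_boot.
Set Implicit Arguments.
Unset Strict Implicit.
Unset Printing Implicit Defensive.

(* Random access machines: natural numbers are held in registers, addressed directly, and in memory
   cells, addressed through registers.  Every instruction costs one step.
   Addition and truncated subtraction are the only arithmetic operations, so one
   step lengthens the largest stored number by at most one bit and the step
   count is polynomially related to Turing machine time. *)

Inductive instr :=
| Const (r c : nat)
| Add (r s t : nat)
| Sub (r s t : nat)
| Read (r s : nat)
| Write (r s : nat)
| Jz (r q : nat).

Definition program := seq instr.

Record state := State { pc : nat; reg : nat -> nat; mem : nat -> nat }.

Definition exec (i : instr) (s : state) : state :=
  let: State k R M := s in
  match i with
  | Const r c => State k.+1 [eta R with r |-> c] M
  | Add r u v => State k.+1 [eta R with r |-> R u + R v] M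
  | Sub r u v => State k.+1 [eta R with r |-> R u - R v] M
  | Read r u  => State k.+1 [eta R with r |-> M (R u)] M
  | Write r u => State k.+1 R [eta M with R r |-> R u]
  | Jz r q    => State (if R r == 0 then q else k.+1) R M
  end.

Definition halted (p : program) (s : state) : bool := size p <= pc s.

Definition step (p : program) (s : state) : state :=
  if onth p (pc s) is Some i then exec i s else s.

Definition init (x : seq nat) : state :=
  State 0 [eta (fun=> 0) with 0 |-> size x] (nth 0 x).

Definition outputs_within (p : program) (x : seq nat) (t y : nat) : Prop :=
  exists n : nat, [/\ n <= t, halted p (iter n (step p) (init x))
                    & reg (iter n (step p) (init x)) 0 = y].

Definition computable (f : nat -> nat) : Prop :=
  exists p : program, forall k : nat,
    exists t : nat, outputs_within p [:: k] t (f k).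

Definition bitlen (n : nat) : nat := (trunc_log 2 n).+1.

Definition input_size (x : seq nat) : nat := \sum_(n <- x) bitlen n.

Record param_problem := ParamProblem {
  instance : Type;
  encode : instance -> seq nat;
  parameter : instance -> nat;
  yes : instance -> Prop }.

Definition fpt (P : param_problem) : Prop :=
  exists (p : program) (f : nat -> nat) (c : nat),
    computable f /\
    forall x : instance P, exists b : bool,
      outputs_within p (encode x)
        (f (parameter x) * input_size (encode x) ^ c) b
      /\ (b <-> yes x).

(* Parallel edges are allowed, loops are not.  The order of the two endpoints of
   an edge has no meaning other than naming the two orientations. *)

Record constraint_graph := ConstraintGraph {
  nvert : nat;
  nedge : nat;
  endpoints : 'I_nedge -> 'I_nvert * 'I_nvert;
  weight : 'I_nedge -> nat;
  min_inflow : 'I_nvert -> nat;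
  no_loop : forall e, (endpoints e).1 != (endpoints e).2;
  weight_gt0 : forall e, 0 < weight e }.

Definition degree (G : constraint_graph) (v : 'I_(nvert G)) : nat :=
  #|[set e : 'I_(nedge G) | (v == (endpoints e).1) || (v == (endpoints e).2)]|.

Definition max_degree (G : constraint_graph) : nat := \max_v @degree G v.

(* [C e = true] orients [e] into its second endpoint. *)
Definition configuration (G : constraint_graph) := {ffun 'I_(nedge G) -> bool}.

Definition head_of (G : constraint_graph) (C : configuration G)
    (e : 'I_(nedge G)) : 'I_(nvert G) :=
  if C e then (endpoints e).2 else (endpoints e).1.

Definition legal (G : constraint_graph) (C : configuration G) : bool :=
  [forall v, min_inflow v <= \sum_(e | head_of C e == v) weight e].

Definition reverse (G : constraint_graph) (C : configuration G)
    (e : 'I_(nedge G)) : configuration G :=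
  [ffun e' => if e' == e then ~~ C e' else C e'].

Definition reversal (G : constraint_graph) : rel (configuration G) :=
  [rel C C' | [exists e, C' == reverse C e]].

(* The sequence is [C :: s]; it makes [size s] edge reversals. *)
Definition reconf_seq (G : constraint_graph) (C : configuration G)
    (s : seq (configuration G)) : bool :=
  all (@legal G) (C :: s) && path (@reversal G) C s.

Definition nb_reversals (G : constraint_graph) (e : 'I_(nedge G))
    (C : configuration G) (s : seq (configuration G)) : nat :=
  count id (pairmap (fun D D' : configuration G => D e != D' e) C s).

Definition bounded_seq (G : constraint_graph) (C : configuration G)
    (s : seq (configuration G)) : Prop :=
  forall e, nb_reversals e C s <= 1.

Definition encode_graph (G : constraint_graph) : seq nat :=
  [:: nvert G; nedge G]
  ++ [seq min_inflow v | v : 'I_(nvert G)]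
  ++ flatten [seq [:: val (endpoints e).1; val (endpoints e).2; weight e]
             | e : 'I_(nedge G)].

Definition encode_config (G : constraint_graph) (C : configuration G) :
    seq nat := [seq nat_of_bool (C e) | e : 'I_(nedge G)].

Record c2c_instance := C2CInstance {
  c2c_graph : constraint_graph;
  c2c_start : configuration c2c_graph;
  c2c_target : configuration c2c_graph;
  c2c_length : nat;
  c2c_start_legal : legal c2c_start;
  c2c_target_legal : legal c2c_target }.

Record c2e_instance := C2EInstance {
  c2e_graph : constraint_graph;
  c2e_edge : 'I_(nedge c2e_graph);
  c2e_start : configuration c2e_graph;
  c2e_length : nat;
  c2e_start_legal : legal c2e_start }.

Definition encode_c2c (x : c2c_instance) : seq nat :=
  encode_graph (c2c_graph x) ++ encode_config (c2c_start x)
  ++ encode_config (c2c_target x) ++ [:: c2c_length x].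

Definition encode_c2e (x : c2e_instance) : seq nat :=
  encode_graph (c2e_graph x) ++ encode_config (c2e_start x)
  ++ [:: val (c2e_edge x); c2e_length x].

Definition c2c_solution (x : c2c_instance)
    (s : seq (configuration (c2c_graph x))) : Prop :=
  [/\ reconf_seq (c2c_start x) s, last (c2c_start x) s = c2c_target x
    & size s <= c2c_length x].

Definition c2e_solution (x : c2e_instance)
    (s : seq (configuration (c2e_graph x))) : Prop :=
  [/\ reconf_seq (c2e_start x) s, 0 < nb_reversals (c2e_edge x) (c2e_start x) s
    & size s <= c2e_length x].

Definition c2c_parameter (x : c2c_instance) : nat :=
  c2c_length x + max_degree (c2c_graph x).

Definition c2e_parameter (x : c2e_instance) : nat :=
  c2e_length x + max_degree (c2e_graph x).

Definition C2C_NCL : param_problem :=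
  ParamProblem encode_c2c c2c_parameter (fun x => exists s, @c2c_solution x s).

Definition bounded_C2C_NCL : param_problem :=
  ParamProblem encode_c2c c2c_parameter
    (fun x => exists s, @c2c_solution x s /\ bounded_seq (c2c_start x) s).

Definition C2E_NCL : param_problem :=
  ParamProblem encode_c2e c2e_parameter (fun x => exists s, @c2e_solution x s).

Definition bounded_C2E_NCL : param_problem :=
  ParamProblem encode_c2e c2e_parameter
    (fun x => exists s, @c2e_solution x s /\ bounded_seq (c2e_start x) s).

(* Main.v *)
Require Import Defs.
From mathcomp Require Import all_boot zify.

Set Implicit Arguments.
Unset Strict Implicit.
Unset Printing Implicit Defensive.

(** Fix an instance with solution length [l] and call an edge a seed if it is the
    target edge (C2E) or has different orientations in the two configurations
    (C2C).  In a solution, group the reversed edges into connected components,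
    where two edges are adjacent when they share an endpoint.  Deleting all the
    reversals of the components without seeds leaves a solution: a vertex is
    touched by at most one component, so its inflow is at every moment either
    the original one or the initial one.  Hence one may assume that each
    reversed edge is the end of a walk of [l] steps from a seed.  There are at
    most [l] seeds and every edge has at most twice the maximum degree many
    neighbours, so such a walk is a word of [l.+1] digits in a base at most
    [2 * (l + Delta) + 1] and a sequence of at most [l] reversals is a number
    below [base ^ (l * l.+1)].  Trying all these numbers takes FPT time.

    The search uses no memory besides its input: it is an expression built from
    bounded recursions, and an expression with all loop counts at most [H]
    compiles to a program [p] that stops within [H.+2 ^ size p] steps. *)

(** * Expressions and their compilation *)

(* Expressions are in parametric higher-order syntax: variables are numbers when
   an expression is evaluated and register names when it is compiled, and
   [related] ties the two readings together. *)
Inductive expr (V : Type) : Type :=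
| Var of V
| Cst of nat
| Plus of expr V & expr V
| Minus of expr V & expr V
| Get of expr V
| Rec of expr V & expr V & (V -> V -> expr V).
Arguments Cst {V} _.

Fixpoint ev (M : nat -> nat) (e : expr nat) : nat :=
  match e with
  | Var v => v
  | Cst n => n
  | Plus a b => ev M a + ev M b
  | Minus a b => ev M a - ev M b
  | Get a => M (ev M a)
  | Rec n z b => iteri (ev M n) (fun i a => ev M (b i a)) (ev M z)
  end.

(** The loop bodies are inspected only at the accumulators that really occur, so this is the largest
    loop count met during evaluation. *)
Fixpoint max_loop (M : nat -> nat) (e : expr nat) : nat :=
  match e with
  | Var _ | Cst _ => 0
  | Plus a b | Minus a b => maxn (max_loop M a) (max_loop M b)
  | Get a => max_loop M a
  | Rec n z b =>
      maxn (maxn (max_loop M n) (max_loop M z))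
        (maxn (ev M n)
          (\max_(i < ev M n)
             max_loop M (b i (iteri i (fun j a => ev M (b j a)) (ev M z)))))
  end.

Inductive related (V W : Type) : seq (V * W) -> expr V -> expr W -> Prop :=
| RelVar G v w of List.In (v, w) G : related G (Var v) (Var w)
| RelCst G n : related G (Cst n) (Cst n)
| RelPlus G a a' b b' of related G a a' & related G b b' :
    related G (Plus a b) (Plus a' b')
| RelMinus G a a' b b' of related G a a' & related G b b' :
    related G (Minus a b) (Minus a' b')
| RelGet G a a' of related G a a' : related G (Get a) (Get a')
| RelRec G n n' z z' b b' of related G n n' & related G z z' &
    (forall i i' a a',
        related [:: (i, i'), (a, a') & G] (b i a) (b' i' a')) :
    related G (Rec n z b) (Rec n' z' b').

(** Code placed at address [q] leaves its value in register [d] and preserves the registers below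
    [d], where the variables in scope live; the registers above are scratch. In a loop, [d] holds
    the number of remaining rounds, [d.+1] the accumulator, [d.+2] the round index and [d.+3] the
    value of the body. Copying is clearing followed by adding, and an unconditional jump is a [Jz]
    on a register just cleared. *)
Fixpoint comp (d q : nat) (e : expr nat) : program :=
  match e with
  | Var r => [:: Const d 0; Add d d r]
  | Cst n => [:: Const d n]
  | Plus a b =>
      let ca := comp d q a in
      ca ++ comp d.+1 (q + size ca) b ++ [:: Add d d d.+1]
  | Minus a b =>
      let ca := comp d q a in
      ca ++ comp d.+1 (q + size ca) b ++ [:: Defs.Sub d d d.+1]
  | Get a => comp d q a ++ [:: Read d d]
  | Rec n z b =>
      let cn := comp d q n in
      let cz := comp d.+1 (q + size cn) z in
      let l := (q + size cn + size cz).+1 in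
      let cb := comp d.+3 l.+1 (b d.+2 d.+1) in
      cn ++ cz ++ [:: Const d.+2 0; Jz d (l + size cb + 8)] ++ cb
      ++ [:: Const d.+1 0; Add d.+1 d.+1 d.+3; Const d.+3 1; Defs.Sub d d d.+3;
             Add d.+2 d.+2 d.+3; Const d.+3 0; Jz d.+3 l; Const d 0;
             Add d d d.+1]
  end.

(** * Correctness and running time of compiled code *)

Definition code_at (p : program) (q : nat) (c : program) : Prop :=
  exists a b, p = a ++ c ++ b /\ size a = q.

Lemma code_at_cat p q c1 c2 :
  code_at p q (c1 ++ c2) -> code_at p q c1 /\ code_at p (q + size c1) c2.
Proof.
move=> [a [b [-> <-]]]; split; first by exists a, (c2 ++ b); rewrite !catA.
by exists (a ++ c1), b; rewrite size_cat !catA.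
Qed.

Lemma step_code p q i c R M : code_at p q (i :: c) ->
  step p (State q R M) = exec i (State q R M).
Proof.
move=> [a [b [-> <-]]]; rewrite /step /= onth_cat ltnn subnn //.
Qed.

Lemma code_at_behead p q i c : code_at p q (i :: c) -> code_at p q.+1 c.
Proof. by rewrite -cat1s => /code_at_cat[_]; rewrite addn1. Qed.

Definition runs (p : program) M (n q : nat) R (q' : nat) R' : Prop :=
  iter n (step p) (State q R M) = State q' R' M.

Lemma runs_trans p M n1 n2 q1 R1 q2 R2 q3 R3 :
  runs p M n1 q1 R1 q2 R2 -> runs p M n2 q2 R2 q3 R3 ->
  runs p M (n1 + n2) q1 R1 q3 R3.
Proof. by rewrite /runs addnC iterD => -> ->. Qed.

Lemma runs1 p M q i c R q' R' : code_at p q (i :: c) ->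
  exec i (State q R M) = State q' R' M -> runs p M 1 q R q' R'.
Proof. by move=> /step_code + E; rewrite /runs /= => ->. Qed.

Lemma runs_jump p M q r q' c R : code_at p q (Jz r q' :: c) -> R r = 0 ->
  runs p M 1 q R q' R.
Proof. by move=> cq Rr; apply: (runs1 cq); rewrite /= Rr. Qed.

(** A bound exponential in the code length is multiplicative under concatenation, and extra
    instructions bring factors [H.+2] that pay for loops of at most [H] rounds. *)
Definition computes (p : program) M H d q (c : program) R v : Prop :=
  exists n R', [/\ runs p M n q R (q + size c) R', n < H.+2 ^ size c, R' d = v
    & forall r, r < d -> R' r = R r].

Section Compile.
Variables (p : program) (M : nat -> nat) (H : nat).

Lemma expH_gt0 n : 0 < H.+2 ^ n. Proof. by rewrite expn_gt0. Qed.

(** For positive [x] and [y], the numbers [a < x] and [n < y] satisfy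
    [a + n + 1 <= x + y - 1 <= x * y]. *)
Lemma cost_add n a s s' : a < H.+2 ^ s -> n < H.+2 ^ s' ->
  a + n + 1 < H.+2 ^ (s + (s' + 1)).
Proof.
rewrite !expnD expn1.
set x := _ ^ s; set y := _ ^ s'; nia.
Qed.

(* [q] is the address of the loop test; [i] rounds are done and [k] remain. *)
Lemma runs_loop d q qe (f : nat -> nat -> nat) cb t i0 :
  code_at p q (Jz d (q + size cb + 8) :: cb ++
     [:: Const d.+1 0; Add d.+1 d.+1 d.+3; Const d.+3 1; Defs.Sub d d d.+3;
             Add d.+2 d.+2 d.+3; Const d.+3 0; Jz d.+3 q] ++ qe) ->
  forall k i z R,
  (forall j R', i <= j < i + k -> R' d.+2 = j ->
     R' d.+1 = iteri j f i0 -> (forall r, r < d -> R' r = R r) ->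
     exists n R'', [/\ runs p M n q.+1 R' (q.+1 + size cb) R'', n <= t,
        R'' d.+3 = f j (R' d.+1) & forall r, r < d.+3 -> R'' r = R' r]) ->
  R d = k -> R d.+2 = i -> R d.+1 = z -> z = iteri i f i0 ->
  exists n R', [/\ runs p M n q R (q + size cb + 8) R', n <= k * (t + 8) + 1,
    R' d.+1 = iteri (i + k) f i0 & forall r, r < d -> R' r = R r].
Proof.
move=> cq; elim=> [|k IH] i z R hb Rd Ri Ra za.
  exists 1, R; split=> //; first by apply: (runs1 cq); rewrite /= Rd.
  by rewrite addn0 Ra.
have [] := hb i R => //; [by rewrite leqnn /= addnS ltnS leq_addr| by rewrite Ra|].
move=> n [R1 [run1 n_t R1v R1r]].
have /code_at_cat[_ c1] := code_at_behead cq.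
(* Registers after the six assignments that close a round: the accumulator takes the value of the
   body, the counter drops, the index grows, and [d.+3] is cleared so that the final [Jz] jumps back
   to the test. *)
set R2 := [eta R1 with d.+1 |-> 0].
set R3 := [eta R2 with d.+1 |-> R2 d.+1 + R2 d.+3].
set R4 := [eta R3 with d.+3 |-> 1].
set R5 := [eta R4 with d |-> R4 d - R4 d.+3].
set R6 := [eta R5 with d.+2 |-> R5 d.+2 + R5 d.+3].
set R7 := [eta R6 with d.+3 |-> 0].
have run2 : runs p M 7 (q.+1 + size cb) R1 q R7.
  rewrite -[7]/(1 + (1 + (1 + (1 + (1 + (1 + 1)))))).
  apply: (runs_trans (@runs1 _ _ _ _ _ R1 _ R2 c1 erefl)).
  have {}c1 := code_at_behead c1.
  apply: (runs_trans (@runs1 _ _ _ _ _ R2 _ R3 c1 erefl)).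
  have {}c1 := code_at_behead c1.
  apply: (runs_trans (@runs1 _ _ _ _ _ R3 _ R4 c1 erefl)).
  have {}c1 := code_at_behead c1.
  apply: (runs_trans (@runs1 _ _ _ _ _ R4 _ R5 c1 erefl)).
  have {}c1 := code_at_behead c1.
  apply: (runs_trans (@runs1 _ _ _ _ _ R5 _ R6 c1 erefl)).
  have {}c1 := code_at_behead c1.
  apply: (runs_trans (@runs1 _ _ _ _ _ R6 _ R7 c1 erefl)).
  have {}c1 := code_at_behead c1.
  have e7 : R7 d.+3 = 0 by rewrite /R7 /= eqxx.
  exact: (@runs_jump p M _ d.+3 q _ R7 c1 e7).
have eqs : (d.+1 == d = false) * (d.+2 == d = false) * (d.+3 == d = false)
  * (d.+2 == d.+1 = false) * (d.+3 == d.+1 = false) * (d.+3 == d.+2 = false)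
  * (d == d.+1 = false) * (d == d.+2 = false) * (d == d.+3 = false)
  * (d.+1 == d.+2 = false) * (d.+1 == d.+3 = false) * (d.+2 == d.+3 = false).
  by repeat split; lia.
have R7d : R7 d = k.
  by rewrite /R7 /R6 /R5 /R4 /R3 /R2 /= !(eqs, eqxx) R1r ?Rd; lia.
have R7i : R7 d.+2 = i.+1.
  by rewrite /R7 /R6 /R5 /R4 /R3 /R2 /= !(eqs, eqxx) R1r ?Ri; lia.
have R7a : R7 d.+1 = f i z.
  by rewrite /R7 /R6 /R5 /R4 /R3 /R2 /= !(eqs, eqxx) R1v Ra.
have R7r r : r < d -> R7 r = R r.
  move=> rd; rewrite -R1r; last lia.
  have eqr : (r == d = false) * (r == d.+1 = false) * (r == d.+2 = false)
    * (r == d.+3 = false).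
    by repeat split; lia.
  by rewrite /R7 /R6 /R5 /R4 /R3 /R2 /= !eqr.
have [] := IH i.+1 _ R7 _ R7d R7i R7a.
- move=> j R' ij Rj Rz Rr; apply: hb => //; first by lia.
  by move=> r rd; rewrite Rr // R7r.
- by rewrite za.
move=> m [R8 [run8 m_t R8a R8r]].
(* A round consists of the test, the body and seven closing instructions, hence [t + 8]. *)
exists (1 + n + 7 + m), R8; split.
- apply: runs_trans run8; apply: runs_trans run2; apply: runs_trans run1.
  by apply: (runs1 cq); rewrite /= Rd.
- by nia.
- by rewrite addnS -addSn.
- by move=> r rd; rewrite R8r // R7r.
Qed.

(** The second operand is computed into [d.+1] and so preserves [d], where the first value waits.
    Its hypothesis ranges over all [R'] that agree with [R] below [d] because the first operand may
    have overwritten anything else. *)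
Lemma computes_binop d q ca cb i (op : nat -> nat -> nat) R va vb :
  (forall q' R', exec i (State q' R' M)
                 = State q'.+1 [eta R' with d |-> op (R' d) (R' d.+1)] M) ->
  code_at p q (ca ++ cb ++ [:: i]) ->
  computes p M H d q ca R va ->
  (forall R', (forall r, r < d -> R' r = R r) ->
     computes p M H d.+1 (q + size ca) cb R' vb) ->
  computes p M H d q (ca ++ cb ++ [:: i]) R (op va vb).
Proof.
move=> execi cq [n1 [R1 [run1 t1 v1 r1]]] hb.
have [_ /code_at_cat[_ ci]] := code_at_cat cq.
have [n2 [R2 [run2 t2 v2 r2]]] := hb _ r1.
exists (n1 + n2 + 1), [eta R2 with d |-> op (R2 d) (R2 d.+1)]; split.
- apply: (runs_trans (runs_trans run1 run2)); apply: (runs1 ci).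
  by rewrite execi !size_cat /=; congr State; lia.
- by rewrite !size_cat /=; exact: cost_add.
- by rewrite /= eqxx v2 r2 // v1.
- by move=> r rd /=; have /negPf-> : r != d by [lia]; rewrite r2 ?r1; lia.
Qed.

(** The induction is on [related], since a loop body is a function and its induction hypothesis must
    cover all values and registers bound by it. [G] pairs the value of each variable in scope with
    the register that holds it. *)
Lemma comp_correct G e e' : related G e e' ->
  forall d q R, code_at p q (comp d q e') ->
  (forall v r, List.In (v, r) G -> r < d /\ R r = v) ->
  max_loop M e <= H ->
  computes p M H d q (comp d q e') R (ev M e).
Proof.
elim=> {G e e'} /=
  [G v r inG|G n|G a a' b b' _ IHa _ IHb|G a a' b b' _ IHa _ IHb|G a a' _ IHa
  |G n n' z z' b b' _ IHn _ IHz _ IHb] d q R cq RG.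
- have [rd Rr] := RG _ _ inG => _.
  exists 2, [eta [eta R with d |-> 0] with d |-> 0 + R r]; split=> /=.
  + rewrite -[2]/(1 + 1) addnA !addn1; apply: (runs_trans (runs1 cq _)); first by [].
    apply: (runs1 (code_at_behead cq)); rewrite /= eqxx.
    by have /negPf-> : r != d by lia.
  + by nia.
  + by rewrite eqxx.
  + by move=> s sd; have /negPf-> : s != d by lia.
- move=> _; exists 1, [eta R with d |-> n]; split=> /=.
  + by rewrite addn1; apply: (runs1 cq).
  + by nia.
  + by rewrite eqxx.
  + by move=> s sd; have /negPf-> : s != d by lia.
- rewrite geq_max => /andP[ha hb].
  have [ca /code_at_cat[cb _]] := code_at_cat cq.
  apply: (computes_binop (op := addn)) => //; first exact: IHa.
  move=> R' R'r; apply: IHb => // v r /RG[rd Rr].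
  by rewrite R'r //; split=> //; lia.
- rewrite geq_max => /andP[ha hb].
  have [ca /code_at_cat[cb _]] := code_at_cat cq.
  apply: (computes_binop (op := subn)) => //; first exact: IHa.
  move=> R' R'r; apply: IHb => // v r /RG[rd Rr].
  by rewrite R'r //; split=> //; lia.
- move=> ha; have [ca cc] := code_at_cat cq.
  have [n1 [R1 [run1 t1 v1 r1]]] := IHa _ _ _ ca RG ha.
  exists (n1 + 1), [eta R1 with d |-> M (R1 d)]; split.
  + apply: (runs_trans run1); apply: (runs1 cc).
    by rewrite /= !size_cat /=; congr State; lia.
  + rewrite size_cat /= expnD expn1; move: t1; set x := _ ^ _; nia.
  + by rewrite /= eqxx v1.
  + by move=> r rd /=; have /negPf-> : r != d by [lia]; rewrite r1; lia.
rewrite !geq_max => /andP[/andP[hn hz] /andP[hN /bigmax_leqP hb]].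
move: cq; set cn := comp d q n'; set cz := comp d.+1 _ z'.
set l := (_ + size cz).+1; set cb := comp d.+3 _ _ => cq.
have [c1 /code_at_cat[c2 c3]] := code_at_cat cq.
have [n1 [R1 [run1 t1 v1 r1]]] := IHn _ _ _ c1 RG hn.
have [|n2 [R2 [run2 t2 v2 r2]]] := IHz _ _ R1 c2 _ hz.
  by move=> v r /RG[rd Rr]; rewrite r1 //; split=> //; lia.
set R3 := [eta R2 with d.+2 |-> 0].
have run3 : runs p M 1 (q + size cn + size cz) R2 l R3 by apply: (runs1 c3).
have c4 := code_at_behead c3.
have c5 : code_at p l (Jz d (l + size cb + 8) :: cb ++
     [:: Const d.+1 0; Add d.+1 d.+1 d.+3; Const d.+3 1; Defs.Sub d d d.+3;
             Add d.+2 d.+2 d.+3; Const d.+3 0; Jz d.+3 l]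
     ++ [:: Const d 0; Add d d d.+1]) by exact: c4.
pose f i a := ev M (b i a).
have [| | | | |n4 [R4 [run4 t4 v4 r4]]] :=
  @runs_loop d l _ f cb (H.+2 ^ size cb) (ev M z) c5 (ev M n) 0 (ev M z) R3.
- move=> j R' /andP[_ jn] R'i R'a R'r.
  (* Inside the body the two newest variables, index and accumulator, live in [d.+2] and [d.+1], and
     the registers from [d.+3] on are free. *)
  have [| | |m [R'' [runb tb vb rb]]] := IHb j d.+2 (R' d.+1) d.+1 d.+3 l.+1 R'.
  + by have [] := code_at_cat (code_at_behead c5).
  + move=> v r /=; case=> [[<- <-]|]; first by split=> //; lia.
    case=> [[<- <-]|inG]; first by split=> //; lia.
    have [rd Rr] := RG _ _ inG; split; first lia.
    rewrite R'r // /R3 /=; have /negPf-> : r != d.+2 by lia.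
    by rewrite r2 ?r1 //; lia.
  + by rewrite R'a; apply: (hb (Ordinal jn)).
  by exists m, R''; split=> //; exact: ltnW.
- by rewrite /R3 /=; have /negPf-> : d != d.+2 by [lia]; rewrite r2.
- by rewrite /R3 /= eqxx.
- by rewrite /R3 /=; have /negPf-> : d.+1 != d.+2 by lia.
- by [].
have [_ c6] := code_at_cat (code_at_behead c5).
have [_ c7] := code_at_cat c6.
set R5 := [eta R4 with d |-> 0].
exists (n1 + n2 + 1 + n4 + 1 + 1), [eta R5 with d |-> R5 d + R5 d.+1]; split.
- have run5 := runs_trans (runs_trans (runs_trans run1 run2) run3) run4.
  (* The exit address lies behind the test, the body and the seven closing instructions; two more
     instructions then copy the accumulator to [d]. *)
  rewrite (_ : l + _ + 8 = l.+1 + size cb + 7) in run5; last lia.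
  have run6 := runs_trans run5 (@runs1 p M _ _ _ R4 _ R5 c7 erefl).
  apply: (runs_trans run6); apply: (runs1 (code_at_behead c7)).
  rewrite /= !size_cat /= !size_cat /= -/l -/cb -/cz -/cn; congr State.
  by rewrite /l; lia.
- rewrite !size_cat /= !size_cat /=.
  rewrite [X in _ ^ X](_ : _ = size cn + size cz + size cb + 11); last lia.
  (* A factor [H.+2 ^ 7] is at least [64 * H.+2], as [H.+2 >= 2]. This covers the loop, which costs
     at most [H.+2 * (9 * w) + 1] because [w + 8 <= 9 * w], and the terms [x], [y] and [4], all
     against the product [x * y * w]. *)
  apply: (@leq_trans (H.+2 ^ (size cn + size cz + size cb + 7))); last first.
    by rewrite leq_exp2l //; lia.
  have p1 := expH_gt0 (size cn); have p2 := expH_gt0 (size cz).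
  have p3 := expH_gt0 (size cb).
  move: t1 t2 t4 p1 p2 p3; rewrite !expnD.
  set x := _ ^ size cn; set y := _ ^ size cz; set w := _ ^ size cb.
  move=> t1 t2 t4 p1 p2 p3.
  have b4 : n4 <= H.+2 * (9 * w) + 1.
    by apply: leq_trans t4 _; rewrite leq_add2r leq_mul //; lia.
  have {t1 t2 t4}b5 : n1 + n2 + 1 + n4 + 1 + 1 < x + y + H.+2 * (9 * w) + 4 by lia.
  apply: (leq_trans b5).
  have X : 0 < x * y * w by rewrite !muln_gt0 p1 p2.
  have hx : x <= x * y * w by rewrite -mulnA leq_pmulr // muln_gt0 p2.
  have hy : y <= x * y * w by rewrite mulnAC leq_pmull // muln_gt0 p1.
  have hw : w <= x * y * w by rewrite leq_pmull // muln_gt0 p1.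
  have h7 : 64 * H.+2 <= H.+2 ^ 7.
    by rewrite expnSr leq_mul2r (@leq_exp2r 2 _ 6).
  apply: (@leq_trans (x * y * w * (64 * H.+2))); last by rewrite leq_mul2l h7 orbT.
  by move: hx hy hw X; set u := x * y * w; nia.
- have dd : (d.+1 == d) = false by apply/eqP; lia.
  by rewrite /R5 /= !eqxx dd v4 add0n.
move=> r rd; rewrite /= /R5 /=.
have /negPf-> : r != d by lia.
rewrite r4 // /R3 /=; have /negPf-> : r != d.+2 by lia.
by rewrite r2 ?r1 //; lia.
Qed.

End Compile.

(** * Compound expressions *)

(** The relational reading of the polymorphic type, for closed expressions; the tactic [relate]
    proves it by following the syntax. *)
Definition parametric (E : forall V, expr V) : Prop :=
  forall V W, related [::] (E V) (E W).

Lemma expr_outputs (E : forall V, expr V) x H : parametric E ->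
  max_loop (nth 0 x) (E nat) <= H ->
  outputs_within (comp 0 0 (E nat)) x (H.+2 ^ size (comp 0 0 (E nat)))
    (ev (nth 0 x) (E nat)).
Proof.
move=> PE leH; set p := comp 0 0 (E nat).
have cp : code_at p 0 p by exists [::], [::]; rewrite cats0.
have [] := comp_correct (PE nat nat) cp (R := reg (init x)) _ leH; first by [].
move=> n [R' [run tn v _]]; exists n.
by rewrite /runs /= in run; rewrite /init run /halted /= ltnW.
Qed.

Section Macros.
Variable V : Type.
Implicit Types a b : expr V.

(** A loop of a single round, whose accumulator serves as the bound variable. *)
Definition LetE a (f : V -> expr V) := Rec (Cst 1) a (fun _ => f).
Definition MulE a b :=
  LetE b (fun y => Rec a (Cst 0) (fun _ s => Plus (Var s) (Var y))).
Definition PowE a b :=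
  LetE a (fun y => Rec b (Cst 1) (fun _ s => MulE (Var y) (Var s))).
Definition SumE a (f : V -> expr V) :=
  Rec a (Cst 0) (fun i s => Plus (Var s) (f i)).
Definition MaxE a (f : V -> expr V) :=
  Rec a (Cst 0) (fun i s =>
    LetE (f i) (fun y => Plus (Var s) (Minus (Var y) (Var s)))).
(** Truth values are 0 and 1, and truncated subtraction supplies the connectives. *)
Definition NotE a := Minus (Cst 1) a.
Definition AndE a b := Minus (Plus a b) (Cst 1).
Definition OrE a b := NotE (Minus (NotE a) b).
Definition LeqE a b := NotE (Minus a b).
Definition EqE a b :=
  LetE a (fun x => LetE b (fun y =>
    AndE (LeqE (Var x) (Var y)) (LeqE (Var y) (Var x)))).
Definition AllE a (f : V -> expr V) := NotE (SumE a (fun i => NotE (f i))).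
Definition ExE a (f : V -> expr V) := NotE (NotE (SumE a f)).
(** The quotient counts the positive multiples of [b] that are at most [a], among the first [a] of
    them. *)
Definition DivE a b :=
  LetE a (fun x => LetE b (fun y => SumE (Var x) (fun i =>
    LeqE (MulE (Plus (Cst 1) (Var i)) (Var y)) (Var x)))).
Definition ModE a b :=
  LetE a (fun x => LetE b (fun y =>
    Minus (Var x) (MulE (DivE (Var x) (Var y)) (Var y)))).

End Macros.

Section Denotation.
Variables (H : nat) (M : nat -> nat).

(** Values and loop counts are tracked together because loop counts are themselves values; [H]
    bounds the loop counts but not the values. *)
Definition den (e : expr nat) (v : nat) : Prop :=
  ev M e = v /\ max_loop M e <= H.

Lemma den_eq e v v' : den e v' -> v = v' -> den e v.
Proof. by move=> ? ->. Qed.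

Lemma den_var v : den (Var v) v. Proof. by []. Qed.

Lemma den_cst n : den (Cst n) n. Proof. by []. Qed.

Lemma den_plus a b x y : den a x -> den b y -> den (Plus a b) (x + y).
Proof. by move=> [<- ha] [<- hb]; split=> //=; rewrite geq_max ha. Qed.

Lemma den_minus a b x y : den a x -> den b y -> den (Minus a b) (x - y).
Proof. by move=> [<- ha] [<- hb]; split=> //=; rewrite geq_max ha. Qed.

Lemma den_get a x : den a x -> den (Get a) (M x).
Proof. by move=> [<- ha]; split. Qed.

Lemma den_rec n z (b : nat -> nat -> expr nat) vn vz f :
  den n vn -> vn <= H -> den z vz ->
  (forall i, i < vn -> den (b i (iteri i f vz)) (f i (iteri i f vz))) ->
  den (Rec n z b) (iteri vn f vz).
Proof.
move=> [<- hn] nH [<- hz] hb.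
have E i : i <= ev M n ->
    iteri i (fun i a => ev M (b i a)) (ev M z) = iteri i f (ev M z).
  elim: i => //= i IH ilt; rewrite IH ?(ltnW ilt) //.
  by have [] := hb _ ilt.
split; first exact: E.
rewrite /= !geq_max hn hz nH; apply/bigmax_leqP => i _.
by rewrite E ?(ltnW (ltn_ord i)) //; have [] := hb i (ltn_ord i).
Qed.

Hypothesis H_gt0 : 0 < H.

Lemma den_let a f x v : den a x -> den (f x) v -> den (LetE a f) v.
Proof.
move=> da df; apply: (@den_rec _ _ _ 1 x (fun _ _ => v)) => //.
by case.
Qed.

Lemma iteri_addn n F : iteri n (fun i s => s + F i) 0 = \sum_(i < n) F i.
Proof. by elim: n => [|n IH]; rewrite ?big_ord0 // big_ord_recr /= IH. Qed.

Lemma den_sum a f n F : den a n -> n <= H ->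
  (forall i, i < n -> den (f i) (F i)) -> den (SumE a f) (\sum_(i < n) F i).
Proof.
move=> da nH df; rewrite -iteri_addn; apply: den_rec => // i ilt.
by apply: den_plus => //; apply: df.
Qed.

(** The left factor is the loop count, so it is the one that has to be at most [H]. *)
Lemma den_mul a b x y : den a x -> x <= H -> den b y -> den (MulE a b) (x * y).
Proof.
move=> da xH db; apply: den_let db _; apply: den_eq.
  by apply: (den_sum (F := fun=> y) da xH).
by rewrite sum_nat_const card_ord.
Qed.

Lemma den_pow a b x y : den a x -> x <= H -> den b y -> y <= H ->
  den (PowE a b) (x ^ y).
Proof.
move=> da xH db yH; apply: (den_let da).
apply: (@den_eq _ _ (iteri y (fun _ s => x * s) 1)).
  by apply: den_rec => // i _; apply: den_mul.
by elim: (y) => //= n <-; rewrite expnS.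
Qed.

Lemma den_max a f n F : den a n -> n <= H ->
  (forall i, i < n -> den (f i) (F i)) -> den (MaxE a f) (\max_(i < n) F i).
Proof.
move=> da nH df.
apply: (@den_eq _ _ (iteri n (fun i s => s + (F i - s)) 0)).
  apply: den_rec => // i ilt; apply: (den_let (df _ ilt)).
  by apply: den_plus => //; apply: den_minus.
elim: (n) => [|m /= <-]; rewrite ?big_ord0 // big_ord_recr /= maxnE //.
Qed.

Lemma den_not a (x : bool) : den a x -> den (NotE a) (~~ x).
Proof. by move=> da; apply: den_eq (den_minus (den_cst 1) da) _; case: x da. Qed.

Lemma den_and a b (x y : bool) : den a x -> den b y -> den (AndE a b) (x && y).
Proof.
move=> da db; apply: den_eq (den_minus (den_plus da db) (den_cst 1)) _.
by case: x y {da db} => -[].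
Qed.

Lemma den_or a b (x y : bool) : den a x -> den b y -> den (OrE a b) (x || y).
Proof.
move=> da db; apply: den_eq.
  by apply: den_minus (den_cst 1) (den_minus (den_not da) db).
by case: x y {da db} => -[].
Qed.

Lemma den_leq a b x y : den a x -> den b y -> den (LeqE a b) (x <= y).
Proof.
move=> da db; apply: den_eq (den_minus (den_cst 1) (den_minus da db)) _.
by rewrite -subn_eq0; case: (x - y).
Qed.

Lemma den_eqE a b x y : den a x -> den b y -> den (EqE a b) (x == y).
Proof.
move=> da db; apply: (den_let da); apply: (den_let db).
by rewrite eqn_leq; apply: den_and; apply: den_leq.
Qed.

Lemma den_ex a f n (F : nat -> bool) : den a n -> n <= H ->
  (forall i, i < n -> den (f i) (F i)) ->
  den (ExE a f) [exists i : 'I_n, F i].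
Proof.
move=> da nH df; have := den_sum da nH df => ds.
apply: den_eq (den_minus (den_cst 1) (den_minus (den_cst 1) ds)) _.
case: (boolP [exists _, _]) => [/existsP[i Fi]|].
  by rewrite (bigD1 i) //= Fi; case: (\sum_(_ < _ | _) _).
by rewrite negb_exists => /forallP h; rewrite big1 // => i _; rewrite (negPf (h i)).
Qed.

Lemma den_all a f n (F : nat -> bool) : den a n -> n <= H ->
  (forall i, i < n -> den (f i) (F i)) ->
  den (AllE a f) [forall i : 'I_n, F i].
Proof.
move=> da nH df.
have ds : den (SumE a (fun i => NotE (f i))) (\sum_(i < n) ~~ F i).
  by apply: (den_sum (F := fun i => ~~ F i)) => // i /df; apply: den_not.
apply: den_eq (den_minus (den_cst 1) ds) _.
case: (boolP [forall _, _]) => [/forallP h|].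
  by rewrite big1 // => i _; rewrite h.
rewrite negb_forall => /existsP[i Fi].
by rewrite (bigD1 i) //= Fi.
Qed.

Lemma sum_ltn_nat n q : \sum_(i < n) (i < q) = minn n q.
Proof.
by elim: n => [|n IH]; rewrite ?big_ord0 ?min0n // big_ord_recr /= IH; lia.
Qed.

Lemma den_div a b x y : den a x -> x <= H -> den b y -> 0 < y ->
  den (DivE a b) (x %/ y).
Proof.
move=> da xH db y0; apply: (den_let da); apply: (den_let db).
apply: (@den_eq _ _ (\sum_(i < x) (i.+1 * y <= x))).
  apply: (den_sum (F := fun i => i.+1 * y <= x)) => // i ix; apply: den_leq => //.
  by apply: den_mul => //; rewrite ?add1n ?(leq_trans ix).
(* The condition [i.+1 * y <= x] says [i < x %/ y], so the sum counts the numbers below the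
   quotient. *)
under eq_bigr do rewrite -leq_divRL //.
by rewrite sum_ltn_nat; apply/esym/minn_idPr/leq_div.
Qed.

Lemma den_mod a b x y : den a x -> x <= H -> den b y -> 0 < y ->
  den (ModE a b) (x %% y).
Proof.
move=> da xH db y0; apply: (den_let da); apply: (den_let db).
apply: (@den_eq _ _ (x - (x %/ y) * y)).
  apply: den_minus => //; apply: den_mul => //; first exact: den_div.
  exact: leq_trans (leq_div _ _) xH.
by rewrite {2}(divn_eq x y) addKn.
Qed.

End Denotation.

Ltac relate := repeat (intros; first
  [ assumption | apply RelCst | apply RelPlus | apply RelMinus | apply RelGet
  | apply RelRec | apply RelVar; simpl; tauto ]).

Lemma parametric_pow_add2 (E : forall V, expr V) c : parametric E ->
  parametric (fun V => PowE (Plus (E V) (Cst 2)) (Cst c)).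
Proof. by move=> PE V W; have PVW := PE V W; relate. Qed.

(** Write [n] for the input size, [k] for the parameter and [c] for the length of the program. Loop
    counts of at most [g k * n] give at most [(g k * n + 2) ^ c] steps, and since [n > 0] this is at
    most [(g k + 2) ^ c * n ^ c]. The expression [gE] shows that the first factor is computable. *)
Lemma fpt_of_expr (P : param_problem) (E gE : forall V, expr V) (g : nat -> nat) :
  parametric E -> parametric gE ->
  (forall k, ev (nth 0 [:: k]) (gE nat) = g k) ->
  (forall x : instance P, 0 < input_size (encode x) /\
     exists b : bool, (b <-> yes x) /\
     den (g (parameter x) * input_size (encode x)) (nth 0 (encode x)) (E nat) b) ->
  fpt P.
Proof.
move=> PE Pg gEg dE; set c := size (comp 0 0 (E nat)).
exists (comp 0 0 (E nat)), (fun k => (g k + 2) ^ c), c; split.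
  exists (comp 0 0 (PowE (Plus (gE nat) (Cst 2)) (Cst c))) => k.
  pose F V := PowE (Plus (gE V) (Cst 2)) (Cst c).
  pose M := nth 0 [:: k].
  exists ((max_loop M (F nat)).+2 ^ size (comp 0 0 (F nat))).
  suff <- : ev M (F nat) = (g k + 2) ^ c.
    by apply: expr_outputs (leqnn _); apply: parametric_pow_add2.
  (* Computability asks for no particular time bound, so [H] only has to be large enough for [den]
     to deliver the value. *)
  rewrite -gEg -/M; set H := maxn (maxn (max_loop M (gE nat)) (ev M (gE nat) + 2)) c.+1.
  have [] // : den H M (F nat) ((ev M (gE nat) + 2) ^ c).
  apply: den_pow; rewrite /H ?leq_max ?leqnn ?leqnSn ?orbT //.
  by apply: den_plus => //; split=> //; rewrite !leq_max leqnn.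
move=> x; have [s0 [b [byes [dEv dEl]]]] := dE x; exists b; split=> //.
have [n [nt hn vn]] := expr_outputs PE dEl.
rewrite dEv in vn; exists n; split=> //.
apply: leq_trans nt _; rewrite -expnMn -/c; case: (c) => // c'.
by rewrite leq_exp2r //; nia.
Qed.

(** * Sequences of reversals *)

Section Moves.
Variable G : constraint_graph.
Implicit Types (C D : configuration G) (e f : 'I_(nedge G)) (ms : seq 'I_(nedge G)).

(** Only the parity of the number of occurrences of each edge matters, so the order of the moves
    drops out and the search can work with counts. *)
Definition after C ms : configuration G :=
  [ffun e => C e (+) odd (count_mem e ms)].

Definition valid C ms : Prop :=
  forall j, j <= size ms -> legal (after C (take j ms)).

Lemma after_nil C : after C [::] = C.
Proof. by apply/ffunP => e; rewrite ffunE addbF. Qed.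

Lemma after_cons C e ms : after C (e :: ms) = after (reverse C e) ms.
Proof.
apply/ffunP => f; rewrite !ffunE /= oddD [f == e]eq_sym.
by case: (e == f) => /=; case: (C f); case: (odd _).
Qed.

Lemma valid_cons C e ms :
  valid C (e :: ms) <-> legal C /\ valid (reverse C e) ms.
Proof.
split=> [v|[lC v]].
  split; first by have := v 0 isT; rewrite take0 after_nil.
  by move=> j jm; have := v j.+1 jm; rewrite /= after_cons.
by case=> [_|j jm]; rewrite ?take0 ?after_nil //= after_cons; apply: v.
Qed.

Lemma nb_reversals_cons e f C (s : seq (configuration G)) :
  nb_reversals e C (reverse C f :: s)
  = (f == e) + nb_reversals e (reverse C f) s.
Proof.
by rewrite /nb_reversals /= ffunE [e == f]eq_sym; case: (f == e); case: (C e).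
Qed.

(** From here on a reconfiguration sequence is represented by the list of its reversed edges;
    multiplicities in the list are numbers of reversals, so boundedness carries over. *)
Lemma reconf_seq_moves C (s : seq (configuration G)) : reconf_seq C s ->
  exists ms, [/\ size ms = size s, valid C ms, last C s = after C ms
    & forall e, nb_reversals e C s = count_mem e ms].
Proof.
elim: s C => [|D s IH] C.
  rewrite /reconf_seq /= !andbT => lC; exists [::]; split=> //.
    by move=> j _; rewrite after_nil.
  by rewrite after_nil.
rewrite /reconf_seq /= => /andP[/andP[lC lD] /andP[/existsP[e /eqP De] pD]].
have [|ms [sz v la nb]] := IH D; first by rewrite /reconf_seq /= lD.
subst D; exists (e :: ms); split=> /=.
- by rewrite sz.
- by apply/valid_cons.
- by rewrite after_cons.
- by move=> f; rewrite nb_reversals_cons nb.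
Qed.

Lemma moves_reconf_seq C ms : valid C ms ->
  exists s : seq (configuration G),
    [/\ reconf_seq C s, size s = size ms, last C s = after C ms
    & forall e, nb_reversals e C s = count_mem e ms].
Proof.
elim: ms C => [|e ms IH] C v.
  exists [::]; split=> //; last by rewrite after_nil.
  by have := v 0 isT; rewrite after_nil /reconf_seq /= => ->.
have [lC /IH[s [rs sz la nb]]] := (valid_cons C e ms).1 v.
exists (reverse C e :: s); split=> /=.
- move: rs; rewrite /reconf_seq /= lC => /andP[-> ->]; rewrite !andbT /=.
  by apply/existsP; exists e.
- by rewrite sz.
- by rewrite after_cons.
- by move=> f; rewrite nb_reversals_cons nb.
Qed.

Definition incident (v : 'I_(nvert G)) e : bool :=
  (v == (endpoints e).1) || (v == (endpoints e).2).

Definition adjacent e f : bool :=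
  incident (endpoints e).1 f || incident (endpoints e).2 f.

Lemma adjacent_refl e : adjacent e e.
Proof. by rewrite /adjacent /incident eqxx. Qed.

Lemma incident_adjacent v e f : incident v e -> incident v f -> adjacent e f.
Proof. by rewrite /adjacent => /orP[]/eqP <- ->; rewrite ?orbT. Qed.

Lemma eq_inflow C D v : {in incident v, C =1 D} ->
  \sum_(e | head_of C e == v) weight e = \sum_(e | head_of D e == v) weight e.
Proof.
move=> eqCD; apply: eq_bigl => e; case: (boolP (incident v e)) => [ie|].
  by rewrite /head_of eqCD.
rewrite negb_or ![v == _]eq_sym => /andP[/negPf n1 /negPf n2].
by rewrite /head_of; case: ifP; case: ifP; rewrite ?n1 ?n2.
Qed.

Lemma take_filter (T : Type) (Q : pred T) (s : seq T) j : j <= size (filter Q s) ->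
  exists2 i, i <= size s & take j (filter Q s) = filter Q (take i s).
Proof.
elim: s j => [|x s IH] j; first by exists 0.
case: j => [_|j /=]; first by exists 0; rewrite ?take0.
case: ifP => Qx /= jl; last first.
  by have [i il E] := IH _ jl; exists i.+1 => //=; rewrite Qx.
by have [i il E] := IH _ jl; exists i.+1 => //=; rewrite Qx E.
Qed.

(* A vertex only sees moves of one connected component of the moved edges, so
   dropping whole components keeps every inflow equal either to the one in the
   original sequence or to the initial one. *)
Lemma valid_filter C ms (Q : pred 'I_(nedge G)) :
  (forall e f, e \in ms -> f \in ms -> adjacent e f -> Q e -> Q f) ->
  valid C ms -> valid C (filter Q ms).
Proof.
move=> clQ vC j /take_filter[i il ->]; apply/forallP => v.
set pre := take i ms.
case: (boolP [exists e, [&& e \in ms, Q e & incident v e]]) => [/existsP[e]|].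
  case/and3P=> ems Qe ve.
  rewrite (@eq_inflow _ (after C pre)); first by have /forallP := vC i il.
  move=> f vf; rewrite !ffunE; congr (_ (+) odd _).
  case: (boolP (f \in pre)) => [/mem_take fms|nf].
    rewrite count_filter; apply: eq_in_count => g _ /=.
    case: eqP => //= ->; apply: clQ Qe => //.
    exact: incident_adjacent vf.
  by rewrite !(count_memPn _) // mem_filter negb_and nf orbT.
rewrite negb_exists => /forallP nQ.
rewrite (@eq_inflow _ C).
  by have := vC 0 isT; rewrite take0 after_nil => /forallP.
move=> f vf; rewrite ffunE (count_memPn _) ?addbF // mem_filter.
apply/negP => /andP[Qf /mem_take fms]; have := nQ f.
by rewrite fms Qf /= -[incident v f]/(f \in incident v) vf.
Qed.

Definition moved_rel ms : rel 'I_(nedge G) :=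
  [rel e f | [&& e \in ms, f \in ms & adjacent e f]].

(** The union of the components of moved edges that contain a seed. A seed that is not moved is
    included too, as [connect] is reflexive. *)
Definition near ms (S : pred 'I_(nedge G)) : pred 'I_(nedge G) :=
  fun e => [exists s, S s && connect (moved_rel ms) s e].

Lemma near_seed ms (S : pred 'I_(nedge G)) e : S e -> near ms S e.
Proof. by move=> Se; apply/existsP; exists e; rewrite Se /=. Qed.

Lemma near_closed ms (S : pred 'I_(nedge G)) e f :
  e \in ms -> f \in ms -> adjacent e f -> near ms S e -> near ms S f.
Proof.
move=> ems fms ef /existsP[s /andP[Ss se]]; apply/existsP; exists s.
rewrite Ss /=; apply: connect_trans se _; apply: connect1.
by apply/and3P.
Qed.

(** The length is exactly [l]: edges are adjacent to themselves, so a shorter walk may wait. *)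
Definition walk (S : pred 'I_(nedge G)) l e (w : nat -> 'I_(nedge G)) : Prop :=
  [/\ S (w 0), w l = e & forall t, t < l -> adjacent (w t) (w t.+1)].

(** On a path without repetitions all edges after the first are distinct members of [ms], so there
    are at most [size ms] steps. *)
Lemma near_walk ms (S : pred 'I_(nedge G)) e l : size ms <= l -> near ms S e ->
  exists w, walk S l e w.
Proof.
move=> ml /existsP[s /andP[Ss /connectP[p pth ->]]] {e}.
case: (shortenP pth) => {}p {}pth up _.
have /uniq_leq_size pms : uniq p by case/andP: up.
have {}pms : size p <= l.
  apply: leq_trans ml; apply: pms => f fp.
  have /(pathP s) pP := pth.
  have := pP (index f p); rewrite index_mem nth_index // => /(_ fp).
  by case/and3P.
(* The default value of [nth] is the last edge, so the walk waits there once the path is used up. *)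
exists (nth (last s p) (s :: p)); split=> //.
  case: (ltngtP l (size p)) => [|h|->]; first lia.
    by rewrite nth_default.
  by rewrite -last_nth.
move=> t tl; case: (ltnP t (size p)) => tp.
  by have /(pathP (last s p))/(_ _ tp)/and3P[] := pth.
rewrite [nth _ _ t.+1]nth_default //=.
case: (ltngtP t (size p)) tp => // [h|->] _.
  by rewrite nth_default // adjacent_refl.
by rewrite -[nth _ _ _]last_nth adjacent_refl.
Qed.

(** Every adjacent edge is counted at one of the two ends of [e] at least. *)
Lemma card_adjacent e : \sum_f adjacent e f <= (max_degree G).*2.
Proof.
have degE v : degree v = \sum_f incident v f.
  rewrite /degree -sum1_card big_mkcond; apply: eq_bigr => f _.
  by rewrite inE -/(incident v f); case: incident.
apply: (@leq_trans (degree (endpoints e).1 + degree (endpoints e).2)).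
  rewrite !degE -big_split leq_sum //= => f _.
  by rewrite /adjacent; case: incident; case: incident.
by rewrite -addnn leq_add // /max_degree leq_bigmax.
Qed.

End Moves.

(** * The search procedure *)

Section Search.
Variables (nv ne l : nat) (mi ep1 ep2 wt c0 : nat -> nat) (seed : nat -> bool).
Variable goal : (nat -> nat) -> bool.

Definition adjn (e f : nat) : bool :=
  [|| ep1 e == ep1 f, ep1 e == ep2 f, ep2 e == ep1 f | ep2 e == ep2 f].

Definition rank (P : nat -> bool) (e : nat) : nat := \sum_(i < e) P i.

(** The member of [P] with rank [b], as a sum with at most one nonzero term. It is 0 if there is no
    such member, which is harmless because [check] examines the resulting moves. *)
Definition select (P : nat -> bool) (b : nat) : nat :=
  \sum_(e < ne) (P e && (rank P e == b)) * e.

(** It exceeds every rank used as a digit: ranks of seeds, of which a solvable instance has at most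
    [l], and ranks among the neighbours of an edge. *)
Definition base : nat := l + 1 + \max_(e < ne) \sum_(f < ne) adjn e f.

Definition digit (K x j : nat) : nat := iter j (divn^~ K) x %% K.

(* The [i]-th move encoded by [x] is the last edge of a walk of length [l] that
   starts at a seed; each of its [l.+1] edges is given by one digit. *)
Definition move (x i : nat) : nat :=
  iteri l (fun t e => select (adjn e) (digit base x (i * l.+1 + t.+1)))
    (select seed (digit base x (i * l.+1))).

Definition count_moves (x j e : nat) : nat := \sum_(i < j) (move x i == e).

Definition headn (b : bool) (e : nat) : nat := b * ep2 e + ~~ b * ep1 e.

Definition legaln (k : nat -> nat) : bool :=
  [forall v : 'I_nv,
     mi v <= \sum_(e < ne) (headn (odd (c0 e + k e)) e == v) * wt e].

(** Legality and goal are tested on the decoded moves themselves, so an accepted [x] always gives a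
    solution, however its digits arose. *)
Definition check (x j : nat) : bool :=
  [&& [forall i : 'I_j, move x i < ne],
      [forall t : 'I_j.+1, legaln (count_moves x t)]
    & goal (count_moves x j)].

Definition search : bool :=
  [exists j : 'I_l.+1, exists x : 'I_(base ^ (l * l.+1)), check x j].

End Search.

(** * Correctness of the search *)

Lemma rank_ltn (P : nat -> bool) e f : e < f -> P e -> rank P e < rank P f.
Proof.
move=> ef Pe; rewrite /rank -!(big_mkord xpredT (fun i => nat_of_bool (P i))).
rewrite (big_cat_nat (leq0n e.+1) ef) /=.
by rewrite big_nat_recr //= Pe addn1 addSn ltnS leq_addr.
Qed.

(** [rank] is strictly increasing on [P], so no other member has the same rank. *)
Lemma select_rank (P : nat -> bool) n e : e < n -> P e ->
  select n P (rank P e) = e.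
Proof.
move=> en Pe; rewrite /select (bigD1 (Ordinal en)) //= Pe eqxx mul1n big1 ?addn0 //.
move=> f /negP nfe; case: (boolP (P f)) => //= Pf.
case: eqP => //= E; case: nfe; apply/eqP/val_inj => /=.
by case: (ltngtP f e) => // h; [have := rank_ltn h Pf | have := rank_ltn h Pe];
  rewrite E ltnn.
Qed.

Lemma rank_leq (P : nat -> bool) n e : e < n -> rank P e <= \sum_(f < n) P f.
Proof.
move=> en; rewrite /rank -!(big_mkord xpredT (fun i => nat_of_bool (P i))).
rewrite [leqRHS](big_cat_nat (leq0n e) (ltnW en)).
exact: leq_addr.
Qed.

Lemma digits_surj K n (g : nat -> nat) : 0 < K -> (forall j, j < n -> g j < K) ->
  exists2 x, x < K ^ n & forall j, j < n -> digit K x j = g j.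
Proof.
move=> K0; elim: n g => [|n IH] g gK; first by exists 0; rewrite ?expn_gt0 ?K0.
have [j jn|x xK xg] := IH (fun j => g j.+1); first exact: gK.
have g0 : g 0 < K by apply: gK.
exists (x * K + g 0).
  by rewrite expnS; nia.
case=> [|j] jn; first by rewrite /digit /= modnMDl modn_small.
by rewrite /digit iterSr divnMDl // divn_small // addn0; apply: xg.
Qed.

Lemma val_surj n (s : seq nat) : all (fun i => i < n) s ->
  exists ms : seq 'I_n, map val ms = s.
Proof.
elim: s => [|i s IH] /=; first by exists [::].
by case/andP=> i_n /IH[ms <-]; exists (Ordinal i_n :: ms).
Qed.

Section Correct.
Variables (G : constraint_graph) (C : configuration G) (l : nat).
Variables (S : pred 'I_(nedge G)) (Goal : seq 'I_(nedge G) -> Prop).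
Variables (mi ep1 ep2 wt c0 : nat -> nat) (seed : nat -> bool).
Variable goal : (nat -> nat) -> bool.
Hypotheses
  (ep1E : forall e : 'I_(nedge G), ep1 e = (endpoints e).1)
  (ep2E : forall e : 'I_(nedge G), ep2 e = (endpoints e).2)
  (wtE : forall e : 'I_(nedge G), wt e = weight e)
  (c0E : forall e : 'I_(nedge G), c0 e = C e)
  (miE : forall v : 'I_(nvert G), mi v = min_inflow v)
  (seedE : forall e : 'I_(nedge G), seed e = S e)
  (goalE : forall (k : nat -> nat) (ms : seq 'I_(nedge G)),
     (forall e : 'I_(nedge G), k e = count_mem e ms) -> goal k <-> Goal ms).

Let nv := nvert G.
Let ne := nedge G.

Lemma adjnE (e f : 'I_ne) : adjn ep1 ep2 e f = adjacent e f.
Proof. by rewrite /adjn !ep1E !ep2E /adjacent /incident orbA. Qed.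

Lemma legalnE (k : nat -> nat) ms : (forall e : 'I_ne, k e = count_mem e ms) ->
  legaln nv ne mi ep1 ep2 wt c0 k = legal (after C ms).
Proof.
move=> kE; apply: eq_forallb => v; rewrite miE; congr (_ <= _).
rewrite [RHS]big_mkcond; apply: eq_bigr => e _.
rewrite wtE c0E kE oddD oddb /head_of ffunE /headn ep1E ep2E.
case: (C e (+) _); rewrite /= !(mul1n, mul0n, addn0, add0n) -val_eqE /=.
all: by case: (_ == _); rewrite ?mul1n.
Qed.

Notation mv := (move ne l ep1 ep2 seed).
Notation cm := (count_moves ne l ep1 ep2 seed).

Lemma count_movesE x j (ms : seq 'I_ne) t (e : 'I_ne) :
  map val ms = map (mv x) (iota 0 j) -> t <= j ->
  cm x t e = count_mem e (take t ms).
Proof.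
move=> msE tj; rewrite /count_moves.
have -> : count_mem e (take t ms) = count_mem (val e) (map val (take t ms)).
  by rewrite count_map; apply: eq_count => f /=.
rewrite map_take msE -map_take take_iota (minn_idPl tj) count_map.
rewrite -sum1_count [RHS]big_mkcond /=.
rewrite -(big_mkord xpredT (fun i => nat_of_bool (mv x i == e))).
by rewrite /index_iota subn0; apply: eq_bigr => i _; case: (_ == _).
Qed.

Lemma check_valid x j (ms : seq 'I_ne) :
  map val ms = map (mv x) (iota 0 j) ->
  check nv ne l mi ep1 ep2 wt c0 seed goal x j <-> valid C ms /\ Goal ms.
Proof.
move=> msE; have szm : size ms = j by rewrite -(size_map val) msE size_map size_iota.
have cE t : t <= j -> forall e : 'I_ne, cm x t e = count_mem e (take t ms).
  by move=> tj e; apply: count_movesE msE tj.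
have gE : goal (cm x j) <-> Goal ms.
  by apply: goalE => e; rewrite cE // -szm take_size.
split.
  case/and3P=> _ /forallP lg /gE ?; split=> // t; rewrite szm => tj.
  by have := lg (Ordinal (tj : t < j.+1)); rewrite (legalnE (cE _ tj)).
case=> v /gE gl; apply/and3P; split=> //; apply/forallP => i.
  have ij : i < size ms by rewrite szm.
  have : mv x i = nth 0 (map val ms) i.
    by rewrite msE (nth_map 0) ?size_iota // nth_iota.
  by rewrite (nth_map (tnth (in_tuple ms) (Ordinal ij))) // => ->; apply: ltn_ord.
have ij : i <= j by rewrite -ltnS.
by rewrite (legalnE (cE _ ij)); apply: v; rewrite szm.
Qed.

(** The first condition bounds the number of seeds by [l], so that a digit can name a seed; the
    second lets the moves that are not near a seed be deleted. *)
Hypothesis Goal_seeds : forall ms, Goal ms -> #|S| <= size ms.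
Hypothesis Goal_filter : forall ms (Q : pred 'I_ne),
  Goal ms -> (forall e, S e -> Q e) -> Goal (filter Q ms).

Notation K := (base ne l ep1 ep2).

Lemma rank_adj_base (e f : 'I_ne) : rank (adjn ep1 ep2 e) f < K.
Proof.
apply: (@leq_ltn_trans (\max_(e < ne) \sum_(f < ne) adjn ep1 ep2 e f)).
  apply: leq_trans (rank_leq _ (ltn_ord f)) _.
  exact: (@leq_bigmax _ (fun e : 'I_ne => \sum_(f < ne) adjn ep1 ep2 e f)).
by rewrite /base -addnA addnCA add1n ltnS leq_addl.
Qed.

Lemma walk_move x i e w : walk S l e w ->
  digit K x (i * l.+1) = rank seed (w 0) ->
  (forall t, t < l ->
     digit K x (i * l.+1 + t.+1) = rank (adjn ep1 ep2 (w t)) (w t.+1)) ->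
  mv x i = e.
Proof.
case=> S0 <- adw d0 dS; rewrite /move.
suff: forall t, t <= l -> iteri t (fun t e => select ne (adjn ep1 ep2 e)
   (digit K x (i * l.+1 + t.+1))) (select ne seed (digit K x (i * l.+1))) = w t.
  exact.
elim=> [_|t IH tl] /=; first by rewrite d0 select_rank ?seedE.
by rewrite IH ?(ltnW tl) // dS // select_rank // adjnE adw.
Qed.

Lemma encode_moves (ms : seq 'I_ne) : size ms <= l -> #|S| <= l ->
  (forall e, e \in ms -> exists w, walk S l e w) ->
  exists2 x, x < K ^ (l * l.+1) & map val ms = map (mv x) (iota 0 (size ms)).
Proof.
move=> ml Sl hw.
have /fin_all_exists[W HW] : forall i : 'I_(size ms),
    exists w, walk S l (tnth (in_tuple ms) i) w.
  by move=> i; apply: hw; apply: mem_tnth.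
(* In the block of a move, digit 0 ranks the start of its walk among the seeds, and each later digit
   ranks the next edge among the neighbours of the current one. *)
pose g (i : 'I_(size ms)) t :=
  if t is t'.+1 then rank (adjn ep1 ep2 (W i t')) (W i t) else rank seed (W i 0).
(* Position [n] is digit [n %% l.+1] of block [n %/ l.+1]; blocks beyond the last move are filled
   with 0. *)
pose G' n := if insub (n %/ l.+1) is Some i then g i (n %% l.+1) else 0.
have K0 : 0 < K by rewrite /base addn1.
have [j jl|x xK xg] := @digits_surj K (l * l.+1) G' K0.
  rewrite /G'; case: insubP => [i _ _|//].
  case: (j %% l.+1) => [|t]; last exact: rank_adj_base.
  rewrite /g; apply: (@leq_ltn_trans l); last first.
    by rewrite /base addn1 addSn ltnS leq_addr.
  apply: leq_trans Sl; apply: leq_trans (rank_leq _ (ltn_ord _)) _.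
  rewrite -sum1_card [leqRHS]big_mkcond leq_sum // => e _.
  by rewrite seedE unfold_in; case: (S e).
exists x => //; apply: (@eq_from_nth _ 0); first by rewrite !size_map size_iota.
move=> i; rewrite size_map => im.
rewrite [RHS](nth_map 0) ?size_iota // nth_iota // add0n.
set e := tnth (in_tuple ms) (Ordinal im); apply/esym.
have eE : nth e ms i = e := esym (tnth_nth e (in_tuple ms) (Ordinal im)).
rewrite (nth_map e) // eE {eE} -[val e]/(nat_of_ord e).
have G'E t : t <= l -> digit K x (i * l.+1 + t) = g (Ordinal im) t.
  move=> tl; rewrite xg.
    rewrite /G' divnMDl // divn_small // addn0 modnMDl modn_small //.
    by rewrite insubT.
  by have : i < l; [apply: leq_trans ml | nia].
apply: (walk_move (HW (Ordinal im))) => [|t tl]; first by rewrite -[i * _]addn0 G'E.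
by rewrite G'E.
Qed.

(** Soundness reads the moves off an accepted [x]. For completeness, a solution is cut down to its
    moves near a seed: it stays valid, still reaches the goal, and every remaining move ends a walk
    that digits can encode. *)
Lemma searchP :
  search nv ne l mi ep1 ep2 wt c0 seed goal <->
  exists ms, [/\ size ms <= l, valid C ms & Goal ms].
Proof.
split.
  case/existsP=> j /existsP[x ch].
  have [ms msE] : exists ms : seq 'I_ne, map val ms = map (mv x) (iota 0 j).
    apply: val_surj; apply/allP => _ /mapP[i + ->]; rewrite mem_iota => ij.
    by case/and3P: ch => /forallP/(_ (Ordinal ij)).
  have [v gl] := (check_valid msE).1 ch; exists ms; split=> //.
  by rewrite -(size_map val) msE size_map size_iota -ltnS.
case=> ms [ml v gl]; set Q := near ms S.
have fl : size (filter Q ms) <= l by rewrite size_filter (leq_trans (count_size _ _)).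
have vQ : valid C (filter Q ms).
  by apply: valid_filter v => e f; apply: near_closed.
have gQ : Goal (filter Q ms) by apply: Goal_filter gl _ => e; apply: near_seed.
have [| |x xK msE] := encode_moves fl; first exact: leq_trans (Goal_seeds gl) ml.
  by move=> e; rewrite mem_filter => /andP[Qe _]; apply: near_walk ml Qe.
apply/existsP; exists (Ordinal (fl : _ < l.+1)); apply/existsP; exists (Ordinal xK).
exact/(check_valid msE).
Qed.

(** Here the maximum degree enters the running time. *)
Lemma base_leq : K <= l + 1 + (max_degree G).*2.
Proof.
rewrite /base leq_add2l; apply/bigmax_leqP => e _.
by apply: leq_trans (card_adjacent e); apply: leq_sum => f _; rewrite adjnE.
Qed.

End Correct.

(** * The search as an expression *)

Section SearchExpr.
Variable V : Type.

(** The input starts with the numbers of vertices and edges, followed by the inflows, three cells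
    per edge, and the start configuration. *)
Definition nvertE : expr V := Get (Cst 0).
Definition nedgeE : expr V := Get (Cst 1).
Definition inflowE (v : V) : expr V := Get (Plus (Cst 2) (Var v)).
Definition edgeE (r : nat) (e : V) : expr V :=
  Get (Plus (Plus (Cst 2) nvertE)
         (Plus (Plus (Plus (Var e) (Var e)) (Var e)) (Cst r))).
Definition startE : expr V :=
  Plus (Plus (Cst 2) nvertE) (Plus (Plus nedgeE nedgeE) nedgeE).
Definition configE (e : V) : expr V := Get (Plus startE (Var e)).

Definition adjacentE (e f : V) : expr V :=
  OrE (EqE (edgeE 0 e) (edgeE 0 f)) (OrE (EqE (edgeE 0 e) (edgeE 1 f))
    (OrE (EqE (edgeE 1 e) (edgeE 0 f)) (EqE (edgeE 1 e) (edgeE 1 f)))).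

Definition selectE (P : V -> expr V) (b : V) : expr V :=
  SumE nedgeE (fun e =>
    MulE (AndE (P e) (EqE (SumE (Var e) P) (Var b))) (Var e)).

Definition baseE (l : V) : expr V :=
  Plus (Plus (Var l) (Cst 1))
    (MaxE nedgeE (fun e => SumE nedgeE (fun f => adjacentE e f))).

Definition digitE (K x : V) (j : expr V) : expr V :=
  ModE (Rec j (Var x) (fun _ y => DivE (Var y) (Var K))) (Var K).

Section Tables.
Variables (seedE : V -> expr V) (goalE : (V -> expr V) -> expr V).
Variables (bd : bool) (l K : V).

Definition moveE (x i : V) : expr V :=
  Rec (Var l)
    (LetE (digitE K x (MulE (Var i) (Plus (Var l) (Cst 1)))) (selectE seedE))
    (fun t e =>
       LetE (digitE K x (Plus (MulE (Var i) (Plus (Var l) (Cst 1)))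
                             (Plus (Var t) (Cst 1))))
         (selectE (adjacentE e))).

Definition countE (x j e : V) : expr V :=
  SumE (Var j) (fun i => EqE (moveE x i) (Var e)).

Definition legalE (x t : V) : expr V :=
  AllE nvertE (fun v => LeqE (inflowE v) (SumE nedgeE (fun e =>
    LetE (ModE (Plus (configE e) (countE x t e)) (Cst 2)) (fun b =>
      MulE (EqE (Plus (MulE (Var b) (edgeE 1 e)) (MulE (NotE (Var b)) (edgeE 0 e)))
               (Var v))
          (edgeE 2 e))))).

(** [bd] selects the program and is not read by the machine, so bounded and unbounded variants share
    one construction. *)
Definition boundedE (k : V -> expr V) : expr V :=
  if bd then AllE nedgeE (fun e => LeqE (k e) (Cst 1)) else Cst 1.

Definition checkE (x j : V) : expr V :=
  AndE (AllE (Var j) (fun i => LeqE (Plus (Cst 1) (moveE x i)) nedgeE))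
    (AndE (AllE (Plus (Var j) (Cst 1)) (legalE x))
          (AndE (goalE (countE x j)) (boundedE (countE x j)))).

End Tables.

Definition searchE (lE : expr V) seedE goalE (bd : bool) : expr V :=
  LetE lE (fun l => LetE (baseE l) (fun K =>
    ExE (Plus (Var l) (Cst 1)) (fun j =>
      ExE (PowE (Var K) (MulE (Var l) (Plus (Var l) (Cst 1)))) (fun x =>
        checkE seedE goalE bd l K x j)))).

End SearchExpr.

(** * Value and loop counts of the search expression *)

Section DenSearch.
Variables (H : nat) (M : nat -> nat).
Notation nv := (M 0).
Notation ne := (M 1).
Notation edge r := (fun e => M (2 + nv + (e + e + e + r))).
Notation ep1 := (edge 0).
Notation ep2 := (edge 1).
Notation wt := (edge 2).
Notation mi := (fun v => M (2 + v)).
Notation c0 := (fun e => M (2 + nv + (ne + ne + ne) + e)).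
Variables (l : nat) (seed : nat -> bool) (goal : (nat -> nat) -> bool).
Variables (bd : bool) (lE : expr nat) (seedE : nat -> expr nat).
Variable goalE : (nat -> expr nat) -> expr nat.
Notation K := (base ne l ep1 ep2).

(** Division and remainder loop as often as their dividend says, so bounds are required on the
    encoded number [x] and, through [l.+2 <= H] and [c0_le1], on the sums whose parity is taken. *)
Hypotheses (nvH : nv <= H) (neH : ne <= H) (lH : l.+2 <= H) (KH : K <= H).
Hypotheses (llH : l * l.+1 <= H) (TH : K ^ (l * l.+1) <= H).
Hypothesis c0_le1 : forall e, e < ne -> c0 e <= 1.
Hypothesis den_l : den H M lE l.
Hypothesis den_seed : forall e, e < ne -> den H M (seedE e) (seed e).
Hypothesis den_goal : forall kE k,
  (forall e, den H M (kE e) (k e) /\ k e <= l) -> den H M (goalE kE) (goal k).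

Definition bounded_count (k : nat -> nat) : bool :=
  bd ==> [forall e : 'I_ne, k e <= 1].

Let H0 : 0 < H. Proof. exact: leq_trans lH. Qed.
Let K0 : 0 < K. Proof. by rewrite /base addn1. Qed.

Hint Resolve den_var den_cst H0 : core.

Lemma den_nedge : den H M (nedgeE nat) ne. Proof. by []. Qed.
Lemma den_nvert : den H M (nvertE nat) nv. Proof. by []. Qed.

Lemma den_edge r e : den H M (edgeE r e) (edge r e).
Proof. by apply: den_get; do !apply: den_plus. Qed.

Lemma den_config e : den H M (configE e) (c0 e).
Proof. by apply: den_get; do !apply: den_plus. Qed.

Hint Resolve den_nedge den_nvert den_edge den_config : core.

Lemma den_adjacent e f : den H M (adjacentE e f) (adjn ep1 ep2 e f).
Proof. by do 3?apply: den_or; apply: den_eqE. Qed.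

Lemma den_select PE P b : (forall e, e < ne -> den H M (PE e) (P e : bool)) ->
  den H M (selectE PE b) (select ne P b).
Proof.
move=> dP; rewrite /select.
apply: (den_sum (F := fun e => (P e && (rank P e == b)) * e)) => // e en.
apply: den_mul => //; last by case: (_ && _).
apply: den_and; first exact: dP.
apply: den_eqE => //; apply: (den_sum (F := fun i => P i)) => //.
  exact: ltnW (leq_trans en neH).
by move=> i ie; apply: dP; apply: ltn_trans en.
Qed.

Lemma den_base : den H M (baseE l) K.
Proof.
apply: den_plus; first exact: den_plus.
apply: (den_max H0 (F := fun e => \sum_(f < ne) adjn ep1 ep2 e f)) => // e _.
by apply: (den_sum (F := fun f => adjn ep1 ep2 e f)) => // f _; apply: den_adjacent.
Qed.

Lemma iter_div_leq x j : iter j (divn^~ K) x <= x.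
Proof. by elim: j => //= j; apply: leq_trans; apply: leq_div. Qed.

Lemma den_digit x jE j : den H M jE j -> j <= H -> x <= H ->
  den H M (digitE K x jE) (digit K x j).
Proof.
move=> dj jH xH; have hH i : iter i (divn^~ K) x <= H.
  exact: leq_trans (iter_div_leq _ _) xH.
have E i : iteri i (fun _ => divn^~ K) x = iter i (divn^~ K) x.
  by elim: i => //= i ->.
apply: den_mod => //; rewrite -E; apply: den_rec => // i _.
by apply: den_div; rewrite ?E.
Qed.

Lemma den_move x i : x <= H -> i < l ->
  den H M (moveE seedE l K x i) (move ne l ep1 ep2 seed x i).
Proof.
move=> xH il; have iH : i <= H by lia.
have d1 : den H M (MulE (Var i) (Plus (Var l) (Cst 1))) (i * l.+1).
  by apply: den_mul => //; rewrite -[l.+1]addn1; apply: den_plus.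
apply: den_rec => //; first lia.
  apply: (@den_let _ _ H0 _ _ (digit K x (i * l.+1))) => //.
    by apply: den_digit => //; nia.
  exact: den_select.
move=> t tl; set e := iteri _ _ _.
apply: (@den_let _ _ H0 _ _ (digit K x (i * l.+1 + t.+1))) => //.
  (* Since [i < l] and [t < l], the digit position stays below [l * l.+1]. *)
  apply: den_digit => //; last by nia.
  by apply: den_plus => //; rewrite -[t.+1]addn1; apply: den_plus.
by apply: den_select => f _; apply: den_adjacent.
Qed.

Lemma den_count x j e : x <= H -> j <= l ->
  den H M (countE seedE l K x j e) (count_moves ne l ep1 ep2 seed x j e).
Proof.
move=> xH jl.
apply: (den_sum (F := fun i => move ne l ep1 ep2 seed x i == e)) => //; first lia.
by move=> i ij; apply: den_eqE => //; apply: den_move => //; lia.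
Qed.

Lemma count_moves_leq x j e : count_moves ne l ep1 ep2 seed x j e <= j.
Proof.
rewrite -[leqRHS]card_ord -sum1_card leq_sum // => i _; exact: leq_b1.
Qed.

Lemma den_legal x t : x <= H -> t <= l ->
  den H M (legalE seedE l K x t)
    (legaln nv ne mi ep1 ep2 wt c0 (count_moves ne l ep1 ep2 seed x t)).
Proof.
move=> xH tl; set k := count_moves _ _ _ _ _ _ _.
apply: (den_all (F := fun v => mi v <=
   \sum_(e < ne) (headn ep1 ep2 (odd (c0 e + k e)) e == v) * wt e)) => // v _.
apply: den_leq; first by apply: den_get; apply: den_plus.
apply: (den_sum (F := fun e =>
  (headn ep1 ep2 (odd (c0 e + k e)) e == v) * wt e)) => // e en.
apply: (@den_let _ _ H0 _ _ (odd (c0 e + k e))) => //.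
  (* The dividend is at most [1 + l]: an initial orientation plus at most [t] moves. *)
  rewrite -modn2; apply: den_mod => //.
    by apply: den_plus => //; apply: den_count.
  have := c0_le1 en; have := count_moves_leq x t e; rewrite -/k; lia.
set b := odd _; apply: den_mul => //; last by case: (_ == _).
apply: den_eqE => //; apply: den_plus; apply: den_mul => //.
- by case: b.
- by apply: den_not.
- by case: b.
Qed.

Lemma den_bounded kE k : (forall e, den H M (kE e) (k e)) ->
  den H M (boundedE bd kE) (bounded_count k).
Proof.
move=> dk; rewrite /boundedE /bounded_count; case: bd => //.
by apply: (den_all (F := fun e => k e <= 1)) => // e _; apply: den_leq.
Qed.

Lemma den_search :
  den H M (searchE lE seedE goalE bd)
    (search nv ne l mi ep1 ep2 wt c0 seed (fun k => goal k && bounded_count k)).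
Proof.
have d1 : den H M (Plus (Var l) (Cst 1)) l.+1 by rewrite -[l.+1]addn1; apply: den_plus.
rewrite /searchE; apply: (den_let H0 den_l); apply: (den_let H0 den_base).
pose chk x j := check nv ne l mi ep1 ep2 wt c0 seed
  (fun k => goal k && bounded_count k) x j.
apply: (den_ex (F := fun j =>
   [exists x : 'I_(K ^ (l * l.+1)), chk x j])) => //; first exact: ltnW.
move=> j jl; apply: (den_ex (F := fun x => chk x j)) => //.
  by apply: den_pow => //; apply: den_mul => //; lia.
move=> x xT; have xH : x <= H := leq_trans (ltnW xT) TH.
have dk e : den H M (countE seedE l K x j e) (count_moves ne l ep1 ep2 seed x j e).
  exact: den_count.
apply: den_and; last apply: den_and; last apply: den_and.
- apply: (den_all (F := fun i => move ne l ep1 ep2 seed x i < ne)) => //; first lia.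
  move=> i ij; apply: den_leq => //; rewrite -[(move _ _ _ _ _ _ _).+1]add1n.
  by apply: den_plus => //; apply: den_move => //; lia.
- apply: (den_all (F := fun t => legaln nv ne mi ep1 ep2 wt c0
    (count_moves ne l ep1 ep2 seed x t))); last 1 first.
  + by move=> t tj; apply: den_legal => //; lia.
  + by rewrite -[j.+1]addn1; apply: den_plus.
  + by lia.
- by apply: den_goal => e; split=> //; apply: leq_trans (count_moves_leq _ _ _) _.
- exact: den_bounded.
Qed.

End DenSearch.

(** * Instances *)

Lemma size_input x : size x <= input_size x.
Proof. by rewrite /input_size -sum1_size leq_sum. Qed.

Lemma nth_map_enum_ord n (F : 'I_n -> nat) (i : 'I_n) :
  nth 0 [seq F j | j : 'I_n] i = F i.
Proof. by rewrite (nth_map i) ?size_enum_ord // nth_ord_enum. Qed.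

Lemma nth_flatten_map (T : Type) x0 (F : T -> seq nat) c s i r :
  (forall x, size (F x) = c) -> i < size s -> r < c ->
  nth 0 (flatten (map F s)) (i * c + r) = nth 0 (F (nth x0 s i)) r.
Proof.
move=> szF + rc; elim: s i => [|x s IH] [|i] //= il.
  by rewrite nth_cat szF rc.
by rewrite nth_cat szF mulSn -addnA ltnNge leq_addr /= addKn IH.
Qed.

Section Layout.
Variables (G : constraint_graph) (C : configuration G) (R : seq nat).
Let M := nth 0 (encode_graph G ++ encode_config C ++ R).
Notation nv := (nvert G).
Notation ne := (nedge G).

Let A := [seq min_inflow v | v : 'I_nv].
Let B := flatten [seq [:: val (endpoints e).1; val (endpoints e).2; weight e]
                 | e : 'I_ne].

Lemma size_vertex_part : size A = nv.
Proof. by rewrite size_map -cardE card_ord. Qed.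

Lemma size_edge_part : size B = ne + ne + ne.
Proof.
rewrite size_flatten /shape -map_comp sumnE big_map.
rewrite (eq_bigr (fun=> 3)) // big_const_seq count_predT iter_addn_0.
by rewrite -cardE card_ord; lia.
Qed.

Lemma layout_tail i :
  M (2 + nv + (ne + ne + ne) + i) = nth 0 (encode_config C ++ R) i.
Proof.
rewrite -addnA -[2 + nv + _]addnA.
rewrite /M /encode_graph -/A -/B /= -catA nth_cat size_vertex_part.
rewrite add0n ltnNge leq_addr /= addKn nth_cat size_edge_part.
by rewrite ltnNge leq_addr /= addKn.
Qed.

Lemma layout_config (e : 'I_ne) : M (2 + nv + (ne + ne + ne) + e) = C e.
Proof.
rewrite layout_tail nth_cat size_map -cardE card_ord ltn_ord.
exact: (nth_map_enum_ord (fun e => nat_of_bool (C e))).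
Qed.

Lemma layout_rest i : M (2 + nv + (ne + ne + ne) + (ne + i)) = nth 0 R i.
Proof.
by rewrite layout_tail nth_cat size_map -cardE card_ord ltnNge leq_addr /= addKn.
Qed.

Lemma layout_inflow (v : 'I_nv) : M (2 + v) = min_inflow v.
Proof.
rewrite /M /encode_graph -/A -/B /= -catA nth_cat size_vertex_part add0n ltn_ord.
exact: nth_map_enum_ord.
Qed.

Lemma layout_edge r (e : 'I_ne) : r < 3 -> M (2 + nv + (e + e + e + r)) =
  nth 0 [:: val (endpoints e).1; val (endpoints e).2; weight e] r.
Proof.
move=> r3; rewrite /M /encode_graph -/A -/B -addnA /= -catA nth_cat size_vertex_part.
rewrite add0n ltnNge leq_addr /= addKn nth_cat size_edge_part.
have -> : e + e + e + r < ne + ne + ne by have := ltn_ord e; lia.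
rewrite (_ : e + e + e + r = e * 3 + r); last lia.
rewrite /B (nth_flatten_map e (c := 3)) ?size_enum_ord //.
by rewrite nth_ord_enum.
Qed.

(** Vertices and edges are listed one by one, so loops over them are linear in the input size. *)
Lemma layout_size : 2 + nv + ne <= input_size (encode_graph G ++ encode_config C ++ R).
Proof.
apply: leq_trans (size_input _); rewrite /encode_graph -/A -/B !size_cat /=.
by rewrite size_vertex_part size_edge_part; lia.
Qed.

End Layout.

(** For [k] the sum of [l] and the maximum degree, the base is at most [k + k + 2] and the number
    [l * l.+1] of digits at most [(k + 1) * (k + 1)]. *)
Definition growth (k : nat) : nat := (k + k + 2) ^ ((k + 1) * (k + 1)).

Definition growthE V : expr V :=
  LetE (Get (Cst 0)) (fun k =>
    PowE (Plus (Plus (Var k) (Var k)) (Cst 2))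
        (MulE (Plus (Var k) (Cst 1)) (Plus (Var k) (Cst 1)))).

Lemma parametric_growth : parametric growthE.
Proof. by move=> V W; relate. Qed.

Lemma ev_growth k : ev (nth 0 [:: k]) (growthE nat) = growth k.
Proof.
pose H := k + k + 2 + (k + 1) * (k + 1).
have H0 : 0 < H by lia.
suff [] : den H (nth 0 [:: k]) (growthE nat) (growth k) by [].
apply: (@den_let _ _ H0 _ _ k); first by apply: (den_get (x := 0)).
have dk c : den H (nth 0 [:: k]) (Plus (Var k) (Cst c)) (k + c).
  exact: den_plus.
apply: den_pow => //; [by rewrite leq_addr| |by rewrite leq_addl].
by apply: den_mul => //; lia.
Qed.

(** * A common scheme for the four problems *)

Section Fpt.
Variables (P : param_problem) (bd : bool).
Variables (lE : forall V, expr V) (seedE : forall V, V -> expr V).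
Variable goalE : forall V, (V -> expr V) -> expr V.
Variables (G : instance P -> constraint_graph).
Variables (C : forall x, configuration (G x)) (l : instance P -> nat).
Variables (S : forall x, pred 'I_(nedge (G x))).
Variables (Goal : forall x, seq 'I_(nedge (G x)) -> Prop).
Variables (seed : instance P -> nat -> bool).
Variables (goal : instance P -> (nat -> nat) -> bool).
Variable (R : instance P -> seq nat).
Notation M x := (nth 0 (encode x)).

Hypothesis parametric_search :
  parametric (fun V => searchE (lE V) (@seedE V) (@goalE V) bd).
Hypothesis encodeE : forall x : instance P,
  encode x = encode_graph (G x) ++ encode_config (C x) ++ R x.
Hypothesis parameterE : forall x : instance P,
  parameter x = l x + max_degree (G x).
Hypothesis yesE : forall x : instance P, yes x <->
  exists ms, [/\ size ms <= l x, valid (C x) ms, Goal ms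
    & bd -> forall e, count_mem e ms <= 1].
Hypothesis seedP : forall x (e : 'I_(nedge (G x))), seed x e = S e.
Hypothesis goalP : forall x (k : nat -> nat) (ms : seq 'I_(nedge (G x))),
  (forall e : 'I_(nedge (G x)), k e = count_mem e ms) -> goal x k <-> Goal ms.
Hypothesis Goal_seeds : forall x (ms : seq 'I_(nedge (G x))),
  Goal ms -> #|@S x| <= size ms.
Hypothesis Goal_filter : forall x ms (Q : pred 'I_(nedge (G x))),
  Goal ms -> (forall e, S e -> Q e) -> Goal (filter Q ms).
Hypothesis den_l : forall x H, den H (M x) (lE nat) (l x).
Hypothesis den_seed : forall x H e, 0 < H -> e < nedge (G x) ->
  den H (M x) (@seedE nat e) (seed x e).
Hypothesis den_goal : forall x H kE k, nedge (G x) <= H -> l x + 2 <= H ->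
  (forall e, den H (M x) (kE e) (k e) /\ k e <= l x) ->
  den H (M x) (@goalE nat kE) (goal x k).

Lemma fpt_search : fpt P.
Proof.
apply: (fpt_of_expr parametric_search parametric_growth ev_growth) => x.
have sz := layout_size (C x) (R x); rewrite -encodeE in sz.
split; first by lia.
have M0 : M x 0 = nvert (G x) by rewrite encodeE.
have M1 : M x 1 = nedge (G x) by rewrite encodeE.
have edgeP r (e : 'I_(nedge (G x))) : r < 3 -> M x (2 + M x 0 + (e + e + e + r)) =
    nth 0 [:: val (endpoints e).1; val (endpoints e).2; weight e] r.
  by move=> r3; rewrite M0 encodeE layout_edge.
have configP (e : 'I_(nedge (G x))) :
    M x (2 + M x 0 + (M x 1 + M x 1 + M x 1) + e) = C x e.
  by rewrite M0 M1 encodeE layout_config.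
pose ep r e := M x (2 + M x 0 + (e + e + e + r)).
pose c0 e := M x (2 + M x 0 + (M x 1 + M x 1 + M x 1) + e).
set k := parameter x; set H := growth k * _.
have pk : k = l x + max_degree (G x) := parameterE x.
have g0 : 0 < growth k by rewrite expn_gt0 addnS.
have gH : growth k <= H by rewrite leq_pmulr //; lia.
have sH : input_size (encode x) <= H by rewrite leq_pmull.
have base_k : base (nedge (G x)) (l x) (ep 0) (ep 1) <= k + k + 2.
  have := @base_leq (G x) (l x) (ep 0) (ep 1) _ _.
  have e1 (e : 'I_(nedge (G x))) : ep 0 e = (endpoints e).1 by exact: edgeP.
  have e2 (e : 'I_(nedge (G x))) : ep 1 e = (endpoints e).2 by exact: edgeP.
  by move=> /(_ e1 e2)/leq_trans -> //; rewrite pk; lia.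
have pow_le n : n <= (k + 1) * (k + 1) -> (k + k + 2) ^ n <= growth k.
  by move=> nk; rewrite /growth leq_exp2l //; lia.
have ll : l x * (l x).+1 <= (k + 1) * (k + 1) by rewrite leq_mul // pk; lia.
have kg : k + k + 2 <= growth k by rewrite -[k + k + 2]expn1 pow_le //; lia.
exists (search (M x 0) (M x 1) (l x) (fun v => M x (2 + v)) (ep 0) (ep 1) (ep 2)
  c0 (seed x) (fun k => goal x k && bounded_count (M x) bd k)); split.
  rewrite yesE M0 M1.
  (* Boundedness becomes part of the goal; it survives filtering because deleting moves only lowers
     the counts. *)
  pose GB (ms : seq 'I_(nedge (G x))) :=
    Goal ms /\ (bd -> forall e, count_mem e ms <= 1).
  have := @searchP (G x) (C x) (l x) (@S x) GB (fun v => M x (2 + v))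
    (ep 0) (ep 1) (ep 2) c0 (seed x)
    (fun k => goal x k && bounded_count (M x) bd k).
  have -> : (exists ms : seq 'I_(nedge (G x)), [/\ size ms <= l x, valid (C x) ms,
     Goal ms & bd -> forall e, count_mem e ms <= 1]) <->
     exists ms, [/\ size ms <= l x, valid (C x) ms & GB ms].
    by split=> -[ms]; [case=> ? ? ? ?|case=> ? ? [? ?]]; exists ms; split.
  apply.
  - by move=> e; exact: edgeP.
  - by move=> e; exact: edgeP.
  - by move=> e; exact: edgeP.
  - exact: configP.
  - by move=> v; rewrite encodeE layout_inflow.
  - exact: seedP.
  - move=> c ms cE; rewrite /GB -(goalP cE) /bounded_count M1.
    split=> [/andP[-> /implyP bc]|[-> bc] /=].
      by split=> // /bc/forallP h e; rewrite -cE.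
    by apply/implyP => /bc h; apply/forallP => e; rewrite cE.
  - by move=> ms [/Goal_seeds].
  - move=> ms Q [gm bm] SQ; split; first exact: Goal_filter.
    move=> b e; rewrite count_filter; apply: leq_trans (bm b e).
    by apply: sub_count => f /andP[].
apply: den_search => //.
- by rewrite M0; lia.
- by rewrite M1; lia.
- by apply: leq_trans gH; apply: leq_trans kg; rewrite pk; lia.
- by rewrite M1; apply: leq_trans base_k _; apply: leq_trans kg gH.
(* Uses [n < b ^ n] for [b > 1], with [n] the number of digits. *)
- apply: leq_trans gH; apply: leq_trans (pow_le _ ll).
  by apply: ltnW; apply: ltn_expl; lia.
- rewrite M1; apply: leq_trans gH; apply: leq_trans (pow_le _ ll).
  by case: (l x * _) => // n; rewrite leq_exp2r.
- move=> e en; have en' : e < nedge (G x) by rewrite -M1.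
  by rewrite (configP (Ordinal en')) leq_b1.
- by move=> e; rewrite M1; apply: den_seed; lia.
- move=> kE c dc; apply: den_goal => //; first by lia.
  by apply: leq_trans gH; apply: leq_trans kg; rewrite pk; lia.
Qed.
End Fpt.

Lemma fpt_iff (I : Type) (enc : I -> seq nat) (par : I -> nat) (Y Y' : I -> Prop) :
  (forall x, Y x <-> Y' x) -> fpt (ParamProblem enc par Y) ->
  fpt (ParamProblem enc par Y').
Proof.
move=> YY' [p [f [c [cf h]]]]; exists p, f, c; split=> // x.
by have [b [out bY]] := h x; exists b; split=> //; rewrite bY; exact: YY'.
Qed.

(** * Seeds and goals of the two problems *)

Section ExtraE.
Variable V : Type.
(** The cells behind the start configuration: the target configuration (C2C) or the target edge
    (C2E), then the solution length. *)
Definition extraE (i : expr V) : expr V :=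
  Get (Plus (startE V) (Plus (nedgeE V) i)).

Definition c2c_lengthE : expr V := extraE (nedgeE V).
Definition c2c_seedE (e : V) : expr V := NotE (EqE (configE e) (extraE (Var e))).
Definition c2c_goalE (k : V -> expr V) : expr V :=
  AllE (nedgeE V) (fun e =>
    EqE (ModE (Plus (configE e) (k e)) (Cst 2)) (extraE (Var e))).

Definition c2e_lengthE : expr V := extraE (Cst 1).
Definition c2e_seedE (e : V) : expr V := EqE (Var e) (extraE (Cst 0)).
Definition c2e_goalE (k : V -> expr V) : expr V :=
  LetE (extraE (Cst 0)) (fun e => LeqE (Cst 1) (k e)).
End ExtraE.

Lemma parametric_c2c bd : parametric (fun V =>
  searchE (c2c_lengthE V) (@c2c_seedE V) (@c2c_goalE V) bd).
Proof. by move=> V W; case: bd; relate. Qed.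

Lemma parametric_c2e bd : parametric (fun V =>
  searchE (c2e_lengthE V) (@c2e_seedE V) (@c2e_goalE V) bd).
Proof. by move=> V W; case: bd; relate. Qed.

Lemma fpt_c2c (bd : bool) : fpt (ParamProblem encode_c2c c2c_parameter
  (fun x => exists s, @c2c_solution x s /\ (bd -> bounded_seq (c2c_start x) s))).
Proof.
pose M x i := nth 0 (encode_c2c x) i.
pose off x := 2 + M x 0 + (M x 1 + M x 1 + M x 1).
pose c0 x e := M x (off x + e); pose c1 x e := M x (off x + (M x 1 + e)).
have c0E x (e : 'I_(nedge (c2c_graph x))) : c0 x e = c2c_start x e.
  exact: (layout_config (c2c_start x)
    (encode_config (c2c_target x) ++ [:: c2c_length x])).
have restE x i : c1 x i = nth 0 (encode_config (c2c_target x) ++ [:: c2c_length x]) i.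
  exact: (layout_rest (c2c_start x)).
have c1E x (e : 'I_(nedge (c2c_graph x))) : c1 x e = c2c_target x e.
  rewrite restE nth_cat size_map -cardE card_ord ltn_ord.
  exact: (nth_map_enum_ord (fun e => nat_of_bool (c2c_target x e))).
have lE x : c1 x (M x 1) = c2c_length x.
  by rewrite restE nth_cat size_map -cardE card_ord ltnn subnn.
have d1 x H e : den H (M x) (extraE (Var e)) (c1 x e) by [].
have d0 x H e : den H (M x) (configE e) (c0 x e) by [].
set P := ParamProblem _ _ _.
apply: (@fpt_search P bd c2c_lengthE c2c_seedE c2c_goalE c2c_graph c2c_start
  c2c_length (fun x e => c2c_start x e != c2c_target x e)
  (fun x ms => after (c2c_start x) ms = c2c_target x)
  (fun x e => c0 x e != c1 x e)
  (fun x k => [forall e : 'I_(nedge (c2c_graph x)),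
     odd (c0 x e + k e) == c1 x e :> nat])
  (fun x => encode_config (c2c_target x) ++ [:: c2c_length x])).
- exact: parametric_c2c.
- by [].
- by [].
- move=> x; split=> [[s [[rs la sz] bs]]|[ms [sz v ga bm]]].
    have [ms [szm v lam nb]] := reconf_seq_moves rs.
    exists ms; split; rewrite ?szm -?lam // => /bs b e.
    by rewrite -nb; apply: b.
  have [s [rs szs la nb]] := moves_reconf_seq v.
  exists s; split; first by split=> //; rewrite ?szs ?la.
  by move=> /bm b e; rewrite nb.
- by move=> x e; rewrite c0E c1E; case: (c2c_start x e); case: (c2c_target x e).
- move=> x k ms kE.
  have E (e : 'I_(nedge (c2c_graph x))) :
      (odd (c0 x e + k e) == c1 x e :> nat)
      = (after (c2c_start x) ms e == c2c_target x e).
    rewrite c0E c1E kE oddD oddb ffunE; by case: (_ (+) _); case: (c2c_target x e).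
  split=> [/forallP h|h]; last by apply/forallP => e; rewrite E h.
  by apply/ffunP => e; apply/eqP; rewrite -E.
(* An edge that never moves keeps its orientation, so every seed occurs in [ms]. *)
- move=> x ms gm; rewrite cardE; apply: uniq_leq_size; first exact: enum_uniq.
  move=> e; rewrite mem_enum unfold_in /= -gm ffunE.
  by apply: contraNT => /count_memPn ->; rewrite addbF.
- move=> x ms Q gm SQ; rewrite -[RHS]gm; apply/ffunP => e.
  case: (boolP (Q e)) => [Qe|nQe].
    rewrite !ffunE count_filter; congr (_ (+) odd _).
    by apply: eq_count => f /=; case: eqP => // ->.
  (* An edge outside [Q] is no seed: its initial orientation, restored by the deletion, is already
     that of the target. *)
  rewrite gm ffunE (count_memPn _); last by rewrite mem_filter negb_and nQe.
  by rewrite addbF; apply/eqP; apply: contraNT nQe; apply: SQ.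
- move=> x H; have : den H (M x) (c2c_lengthE nat) (c1 x (M x 1)) by [].
  by rewrite lE.
- by move=> x H e H0 _; apply: den_not; apply: den_eqE.
- move=> x H kE k neH lH dk.
  apply: (den_all (F := fun e => odd (c0 x e + k e) == c1 x e :> nat)) => //.
  move=> e en; have [dke kl] := dk e; apply: den_eqE => //; first lia.
  rewrite -modn2; apply: den_mod => //; [lia|exact: den_plus|].
  by rewrite (c0E x (Ordinal en)); case: (c2c_start _ _) => /=; lia.
Qed.

Lemma fpt_c2e (bd : bool) : fpt (ParamProblem encode_c2e c2e_parameter
  (fun x => exists s, @c2e_solution x s /\ (bd -> bounded_seq (c2e_start x) s))).
Proof.
pose M x i := nth 0 (encode_c2e x) i.
have extraP x i : M x (2 + M x 0 + (M x 1 + M x 1 + M x 1) + (M x 1 + i))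
    = nth 0 [:: val (c2e_edge x); c2e_length x] i.
  exact: (layout_rest (c2e_start x)).
have dX x H i : den H (M x) (extraE (Cst i))
    (nth 0 [:: val (c2e_edge x); c2e_length x] i).
  by rewrite -extraP.
set P := ParamProblem _ _ _.
apply: (@fpt_search P bd c2e_lengthE c2e_seedE c2e_goalE c2e_graph c2e_start
  c2e_length (fun x e => e == c2e_edge x)
  (fun x ms => c2e_edge x \in ms)
  (fun x e => e == val (c2e_edge x))
  (fun x k => 0 < k (val (c2e_edge x)))
  (fun x => [:: val (c2e_edge x); c2e_length x])).
- exact: parametric_c2e.
- by [].
- by [].
- move=> x; split=> [[s [[rs la sz] bs]]|[ms [sz v ga bm]]].
    have [ms [szm v lam nb]] := reconf_seq_moves rs.
    exists ms; split; rewrite ?szm //.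
      by rewrite -has_pred1 has_count -nb.
    by move=> /bs b e; rewrite -nb; apply: b.
  have [s [rs szs la nb]] := moves_reconf_seq v.
  exists s; split; last by move=> /bm b e; rewrite nb.
  by split=> //; rewrite ?szs // nb -has_count has_pred1.
- by [].
- by move=> x k ms kE; rewrite kE -has_count has_pred1.
(* The target edge is the only seed, and [ms] contains it and is thus nonempty. *)
- move=> x ms; rewrite (@eq_card1 _ (c2e_edge x)); last by [].
  by case: ms.
- by move=> x ms Q gm SQ; rewrite mem_filter gm SQ.
- by move=> x H; apply: (dX x H 1).
- by move=> x H e H0 _; apply: den_eqE => //; apply: (dX x H 0).
- move=> x H kE k neH lH dk; have H0 : 0 < H by lia.
  apply: (den_let H0 (dX x H 0)); apply: den_leq => //.
  by have [] := dk (val (c2e_edge x)).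
Qed.

Theorem theorem15 :
  [/\ fpt bounded_C2E_NCL, fpt C2E_NCL, fpt bounded_C2C_NCL & fpt C2C_NCL].
Proof.
split.
- apply: fpt_iff (fpt_c2e true) => x.
  by split=> -[s [? h]]; exists s; split=> //; apply: h.
- apply: fpt_iff (fpt_c2e false) => x.
  by split=> -[s h]; exists s => //; case: h.
- apply: fpt_iff (fpt_c2c true) => x.
  by split=> -[s [? h]]; exists s; split=> //; apply: h.
- apply: fpt_iff (fpt_c2c false) => x.
  by split=> -[s h]; exists s => //; case: h.
Qed.
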